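(* Let $d\in\mathbb{N}$, let $\alpha>1/2$ be a real number, let $\boldsymbol{\gamma}=(\gamma_1,\gamma_2,\ldots)$ be a sequence of real numbers with $0\le \gamma_j\le 1$ for all $j$, and let $\eta\in(0,1)$. For integers $M\ge 2$ satisfying $$(1-\eta)M \;\ge\; \inf_{1/2\le \lambda'<\alpha}\, 2\prod_{j=1}^{d}\left(1+2\gamma_j^{1/\lambda'}\zeta(\alpha/\lambda')\right),$$ put $$r=\left\lceil -(2\alpha+1)\frac{\log M}{\log(1-\eta)}\right\rceil .$$ Then for any $1/2\le\lambda<\alpha$ and $0<\delta\le 1/\alpha$ there is a constant $C>0$, independent of $M$ (but possibly depending on $d,\alpha,\boldsymbol{\gamma},\eta,\lambda,\delta$), such that $$e^{\mathrm{rms}}(H_{\alpha,\boldsymbol{\gamma}};\tilde A^{\mathrm{ran}}_{r,M})\le C\,M^{-\lambda-1/2+\lambda\delta/2}\log M$$ for all such $M$; this order is arbitrarily close to $M^{-\alpha-1/2}$ when $\lambda\to\alpha^-$ and $\delta\to0^+$. Moreover, if $\sum_{j=1}^{\infty}\gamma_j^{1/\alpha}<\infty$, then the constant $C$ can be chosen independently of the dimension $d$.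
   Context: $\zeta$ is the Riemann zeta function. Weighted Korobov space. For $\boldsymbol{k}\in\mathbb{Z}^d$ let $r_{\alpha,\boldsymbol{\gamma}}(\boldsymbol{k})=\prod_{j:\,k_j\neq 0}|k_j|^{\alpha}/\gamma_j$ (empty product $=1$; $|k_j|^\alpha/\gamma_j=\infty$ if $\gamma_j=0$; $1/\infty=0$, $\infty\cdot 0=0$). For $\alpha>1/2$, $H_{\alpha,\boldsymbol{\gamma}}$ is the space of functions $f:[0,1]^d\to\mathbb{R}$, one-periodic in each variable, with absolutely convergent Fourier series $f(\boldsymbol{x})=\sum_{\boldsymbol{k}\in\mathbb{Z}^d}\hat f(\boldsymbol{k})e^{2\pi i\boldsymbol{k}\cdot\boldsymbol{x}}$, where $\hat f(\boldsymbol{k})=\int_{[0,1]^d}f(\boldsymbol{x})e^{-2\pi i\boldsymbol{k}\cdot\boldsymbol{x}}\,d\boldsymbol{x}$, such that $\hat f(\boldsymbol{k})=0$ whenever $r_{\alpha,\boldsymbol{\gamma}}(\boldsymbol{k})=\infty$ and $\|f\|_{\alpha,\boldsymbol{\gamma}}^2=\sum_{\boldsymbol{k}}|\hat f(\boldsymbol{k})|^2 r_{\alpha,\boldsymbol{\gamma}}(\boldsymbol{k})^2<\infty$. Lattice rules. $I(f)=\int_{[0,1]^d}f(\boldsymbol{x})\,d\boldsymbol{x}$. For $N\ge 2$ and $\boldsymbol{z}\in\{1,\ldots,N-1\}^d$, the rank-1 lattice point set is $P_{N,\boldsymbol{z}}=\{(\{nz_1/N\},\ldots,\{nz_d/N\}):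 0\le n<N\}$, with $\{x\}=x-\lfloor x\rfloor$. For $\boldsymbol{\Delta}\in[0,1]^d$, $P_{N,\boldsymbol{z}}+\boldsymbol{\Delta}=\{(\{x_1+\Delta_1\},\ldots,\{x_d+\Delta_d\}):\boldsymbol{x}\in P_{N,\boldsymbol{z}}\}$. For an $N$-element point set $P$, $Q_P(f)=\frac1N\sum_{\boldsymbol{x}\in P}f(\boldsymbol{x})$, and the worst-case error is $e^{\mathrm{wor}}(H_{\alpha,\boldsymbol{\gamma}};Q_P)=\sup_{\|f\|_{\alpha,\boldsymbol{\gamma}}\le 1}|I(f)-Q_P(f)|$. Algorithm (inputs $\alpha,\boldsymbol{\gamma},r,M$): (1) draw $N$ uniformly from $\mathcal{P}_M=\{p \text{ prime}: \lceil M/2\rceil<p\le M\}$; (2) given $N$, draw $\boldsymbol{z}_1,\ldots,\boldsymbol{z}_r$ independently and uniformly from $\{1,\ldots,N-1\}^d$; (3) let $\boldsymbol{z}^*$ be a vector among $\boldsymbol{z}_1,\ldots,\boldsymbol{z}_r$ minimizing $e^{\mathrm{wor}}(H_{\alpha,\boldsymbol{\gamma}};Q_{P_{N,\boldsymbol{z}_j}})$ (ties broken by any fixed rule). The randomly shifted rule $\tilde A^{\mathrm{ran}}_{r,M}$ is the random rule $Q_{P_{N,\boldsymbol{z}^*}+\boldsymbol{\Delta}}$, where $\boldsymbol{\Delta}$ is uniform on $[0,1]^d$ and independent of $N,\boldsymbol{z}_1,\ldots,\boldsymbol{z}_r$. Its worst-case root-mean-squared error is $$e^{\mathrm{rms}}(H_{\alpha,\boldsymbol{\gamma}};\tilde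 A^{\mathrm{ran}}_{r,M})=\sup_{f\in H_{\alpha,\boldsymbol{\gamma}},\ \|f\|_{\alpha,\boldsymbol{\gamma}}\le 1}\left(\mathbb{E}_{N,\boldsymbol{z}_1,\ldots,\boldsymbol{z}_r,\boldsymbol{\Delta}}\left[|I(f)-Q_{P_{N,\boldsymbol{z}^*}+\boldsymbol{\Delta}}(f)|^2\right]\right)^{1/2}.$$ *)

(* Defs.v *)
From HB Require Import structures.
From mathcomp Require Import all_boot all_order all_algebra.
From mathcomp Require Import all_classical all_reals all_analysis.
From mathcomp Require Import complex.
From mathcomp.analysis.showcase Require summability.
Import numFieldNormedType.Exports.

Set Implicit Arguments.
Unset Strict Implicit.
Unset Printing Implicit Defensive.

Import Order.TTheory GRing.Theory Num.Theory.

Local Open Scope classical_set_scope.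
Local Open Scope ring_scope.
Local Open Scope complex_scope.

Section tuple_cons.
Context {dT : measure_display} {T : measurableType dT}.

Definition tuple_cons (d : nat) (p : T * d.-tuple T) : d.+1.-tuple T :=
  [tuple of p.1 :: p.2].

Lemma measurable_tuple_cons (d : nat) : measurable_fun setT (@tuple_cons d).
Proof. exact: measurable_cons. Qed.

HB.instance Definition _ (d : nat) :=
  isMeasurableFun.Build _ _ _ _ (@tuple_cons d) (@measurable_tuple_cons d).

End tuple_cons.

Section product_prob.
Context {d1 d2 : measure_display} {T1 : measurableType d1}
  {T2 : measurableType d2} {R : realType}.
Variables (P1 : probability T1 R) (P2 : probability T2 R).

Definition product_prob : set (T1 * T2) -> \bar R := (P1 \x P2)%E.

HB.instance Definition _ := Measure.on product_prob.

Lemma product_prob_setT : product_prob setT = 1%E.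
Proof.
rewrite /product_prob -setXTT product_measure1E// -[RHS]mule1.
by congr (_ * _)%E; exact: probability_setT.
Qed.

HB.instance Definition _ :=
  Measure_isProbability.Build _ _ _ product_prob product_prob_setT.

End product_prob.

Fixpoint power_prob {dT : measure_display} {T : measurableType dT}
    {R : realType} (P : probability T R) (d : nat) :
    probability (d.-tuple T) R :=
  if d is d'.+1 then
    distribution (product_prob P (power_prob P d')) (@tuple_cons _ _ d')
  else dirac [tuple].

(* Lebesgue measure restricted to [0, 1]^d. It is both the measure in the
   integral over [0, 1]^d and the law of the random shift. *)
Definition cube_measure (R : realType) (d : nat) :
    probability (d.-tuple (measurableTypeR R)) R :=
  power_prob (uniform_prob (@ltr01 R)) d.

Section korobov.
Context {R : realType} (d : nat).

Definition in_cube (x : d.-tuple R) : Prop :=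
  forall j : 'I_d, 0 <= tnth x j <= 1.

(* A function on [0, 1]^d that is one-periodic in each variable is represented
   by its periodic extension to R^d. *)
Definition one_periodic (f : d.-tuple R -> R) : Prop :=
  forall (x : d.-tuple R) (j : 'I_d),
    f [tuple tnth x i + (i == j)%:R | i < d] = f x.

Definition cube_integral (f : d.-tuple R -> R) : R :=
  \int[cube_measure R d]_x f x.

Definition expi (t : R) : R[i] := cos t +i* sin t.

(* 2 pi k . x *)
Definition phase (k : d.-tuple int) (x : d.-tuple R) : R :=
  2 * pi * \sum_(j < d) (tnth k j)%:~R * tnth x j.

(* The integral of f(x) e^{- 2 pi i k . x}, by real and imaginary parts. *)
Definition fourier_coef (f : d.-tuple R -> R) (k : d.-tuple int) : R[i] :=
  cube_integral (fun x => f x * cos (phase k x)) -i*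
  cube_integral (fun x => f x * sin (phase k x)).

Variables (alpha : R) (gam : nat -> R).

(* The weight gamma_{j + 1} of the sequence (gamma_1, gamma_2, ...) is gam j. *)
Definition weight_r (k : d.-tuple int) : \bar R :=
  (\prod_(j < d | tnth k j != 0%R)
     if gam j == 0%R then +oo
     else ((`|(tnth k j)%:~R| `^ alpha) / gam j)%:E)%E.

Definition korobov_norm (f : d.-tuple R -> R) : \bar R :=
  ((\esum_(k in [set: d.-tuple int])
      ((ComplexField.Normc.normc (fourier_coef f k) ^+ 2)%:E * weight_r k ^+ 2))
    `^ 2^-1)%E.

(* The Fourier series is summed unconditionally, as the limit of its partial
   sums along the filter of finite subsets of Z^d. *)
Definition korobov (f : d.-tuple R -> R) : Prop :=
  [/\ one_periodic f,
      (\esum_(k in [set: d.-tuple int])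
         (ComplexField.Normc.normc (fourier_coef f k))%:E < +oo)%E,
      forall x, in_cube x ->
        summability.partial_sum
          (fun k : d.-tuple int => fourier_coef f k * expi (phase k x) : R[i]^o)
          @ summability.totally --> ((f x)%:C : R[i]^o),
      forall k, weight_r k = +oo%E -> fourier_coef f k = 0
    & (korobov_norm f < +oo)%E].

Definition korobov_ball : set (d.-tuple R -> R) :=
  [set f | korobov f /\ (korobov_norm f <= 1)%E].

End korobov.

Section lattice_rules.
Context {R : realType} (d : nat).

Definition frac_part (x : R) : R := x - (Num.floor x)%:~R.

(* N-element point sets are families indexed by 'I_N. For N prime and d > 0
   the families below are injective. *)
Definition lattice_points (N : nat) (z : d.-tuple 'I_N) (n : 'I_N) :
    d.-tuple R :=
  [tuple frac_part (n%:R * (tnth z j)%:R / N%:R) | j < d].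

Definition shift_points (N : nat) (P : 'I_N -> d.-tuple R) (D : d.-tuple R)
    (n : 'I_N) : d.-tuple R :=
  [tuple frac_part (tnth (P n) j + tnth D j) | j < d].

Definition qmc (N : nat) (P : 'I_N -> d.-tuple R) (f : d.-tuple R -> R) : R :=
  N%:R^-1 * \sum_(n < N) f (P n).

Definition wce (alpha : R) (gam : nat -> R) (N : nat)
    (P : 'I_N -> d.-tuple R) : \bar R :=
  ereal_sup [set `|cube_integral f - qmc P f|%:E
            | f in korobov_ball alpha gam].

End lattice_rules.

Section algorithm.
Context {R : realType}.

(* uphalf M is the ceiling of M / 2. *)
Definition window_primes (M : nat) : {set 'I_M.+1} :=
  [set p : 'I_M.+1 | prime p & (uphalf M < p)%N].

(* {1, ..., N - 1}^d *)
Definition generators (d N : nat) : {set d.-tuple 'I_N} :=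
  [set z : d.-tuple 'I_N | [forall j, (0 < tnth z j)%N]].

(* ({1, ..., N - 1}^d)^r: r independent uniform draws from {1, ..., N - 1}^d
   are one uniform draw from this set. *)
Definition draws (d N r : nat) : {set r.-tuple (d.-tuple 'I_N)} :=
  [set Z : r.-tuple (d.-tuple 'I_N) | [forall i, tnth Z i \in generators d N]].

Definition selection (d r : nat) : Type :=
  forall N : nat, r.-tuple (d.-tuple 'I_N) -> d.-tuple 'I_N.

(* zstar N Z is a best vector of Z. The tie-breaking rule is arbitrary: zstar
   may depend on N and on the whole tuple Z. *)
Definition best_selection (d r M : nat) (alpha : R) (gam : nat -> R)
    (zstar : selection d r) : Prop :=
  forall N : 'I_M.+1, N \in window_primes M ->
  forall Z : r.-tuple (d.-tuple 'I_N), Z \in draws d N r ->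
    zstar N Z \in (Z : seq _) /\
    forall z, z \in (Z : seq _) ->
      (wce alpha gam (lattice_points (R := R) (zstar N Z))
        <= wce alpha gam (lattice_points (R := R) z))%E.

(* Expectation of F(X) for X uniform on the nonempty finite set A. *)
Definition unif_mean (T : finType) (A : {set T}) (F : T -> \bar R) : \bar R :=
  ((#|A|%:R^-1)%:E * \sum_(a in A) F a)%E.

Definition mean_squared_error (d r M : nat) (zstar : selection d r)
    (f : d.-tuple R -> R) : \bar R :=
  unif_mean (window_primes M) (fun N : 'I_M.+1 =>
  unif_mean (draws d N r) (fun Z =>
    (\int[cube_measure R d]_D
      (`|cube_integral f
          - qmc (shift_points (lattice_points (zstar N Z)) D) f| ^+ 2)%:E)%E)).

Definition rms_error (d r M : nat) (alpha : R) (gam : nat -> R)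
    (zstar : selection d r) : \bar R :=
  ereal_sup [set (mean_squared_error M zstar f `^ 2^-1)%E
            | f in korobov_ball alpha gam].

(* The Riemann zeta function, at real s > 1 only. *)
Definition zeta (s : R) : R := limn (series (fun n => n.+1%:R `^ (- s))).

Definition M_admissible (d : nat) (alpha eta : R) (gam : nat -> R) (M : nat) :
    Prop :=
  (2 <= M)%N /\
  inf [set 2 * \prod_(j < d) (1 + 2 * gam j `^ l^-1 * zeta (alpha / l))
      | l in [set l : R | 2^-1 <= l < alpha]] <= (1 - eta) * M%:R.

(* The ceiling is positive for M >= 2 and 0 < eta < 1, so that the absolute
   value only converts from int to nat. *)
Definition num_draws (alpha eta : R) (M : nat) : nat :=
  `|Num.ceil (- ((2 * alpha + 1) * (ln M%:R / ln (1 - eta))))|%N.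

Definition rate (lambda delta : R) : R :=
  - lambda - 2^-1 + lambda * delta / 2.

Definition rms_bound (d : nat) (alpha eta : R) (gam : nat -> R)
    (lambda delta C : R) : Prop :=
  forall M : nat, M_admissible d alpha eta gam M ->
  forall zstar : selection d (num_draws alpha eta M),
    best_selection M alpha gam zstar ->
    (rms_error M alpha gam zstar
      <= (C * M%:R `^ rate lambda delta * ln M%:R)%:E)%E.

End algorithm.

(* Main.v *)
Require Import Defs.
From mathcomp Require Import all_boot all_order all_algebra.
From mathcomp Require Import all_classical all_reals all_analysis.
From mathcomp Require Import measurable_realfun finmap complex.
From mathcomp Require Import ring lra zify.
Import numFieldNormedType.Exports.
Import Order.TTheory GRing.Theory Num.Theory.

Set Implicit Arguments.
Unset Strict Implicit.
Unset Printing Implicit Defensive.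

Local Open Scope classical_set_scope.
Local Open Scope ring_scope.

(** Write rho(k) = 1 / r(k), with rho(k) = 0 where r(k) is infinite ([decay]).
    For a lattice rule with generator z, averaging the squared error over the
    shift leaves the sum of |fhat(k)|^2 over the nonzero k with
    k.z = 0 mod N (the dual lattice), because the trigonometric monomials are
    orthonormal and the rule integrates e(k.x) to 0 off the dual lattice and
    to e(k.Delta) on it.  Since |fhat(k)|^2 = rho(k)^2 w(k) with
    sum_k w(k) <= 1 on the unit ball, it suffices to bound, uniformly in
    k <> 0, the quantity rho(k)^2 P(k.z* = 0 mod N) ([mse_le]).

    Two properties of the worst-case error make this possible.  Testing it on
    rho(k) cos(2 pi k.x) shows that rho(k) is at most the worst-case error for
    every k <> 0 in the dual lattice ([decay_le_wce]).  By
    Cauchy-Schwarz the worst-case error is at most (sum rho(k)^2)^(1/2), hence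
    at most (sum rho(k)^(1/lambda))^lambda, the sums being over the dual
    lattice without 0 ([wce_le], [good_wce]).

    The mean of sum rho(k)^(1/lambda) over all generators is O(1/N)
    ([sum_dual_sum]): a frequency that N does not divide has k.z = 0 for a
    proportion at most 1/(N-1) of the generators, and for the others
    rho(N l)^(1/lambda) <= N^(-alpha/lambda) rho(l)^(1/lambda) with
    alpha/lambda > 1.  By Markov's inequality a
    proportion at least eta of the generators is good, in the sense that the
    worst-case error is at most B = O(M^(-lambda)) ([card_bad]).

    Fix k <> 0.  For the primes N that do not divide k, either all r draws are
    bad, which has probability at most (1-eta)^r <= M^(-2 alpha-1) by the choice
    of r, or the selected vector has worst-case error at most B, so that k
    only matters if rho(k) <= B, and then a union bound over the draws gives
    B^2 r / (N-1) = O(M^(-2 lambda-1) log M) ([draws_hit]).  For the q primes N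
    of the window that divide k, some |k_j| is at least their product, so
    q rho(k)^2 <= (M/2)^(-2 alpha) ([card_window_divisible]), and the window
    holds at least c M / log M primes when it holds any
    ([window_primes_card_ge]).  The last bound is Chebyshev's estimate for
    the interval (M/2, M], obtained from the prime factorization of the
    central binomial coefficient as in Erdos' proof of Bertrand's postulate.

    The dimension enters only through a bound S on sum_k rho(k)^(1/lambda), at
    most the product of the factors
    1 + 2 gamma_j^(1/lambda) zeta(alpha/lambda) ([sum_decay_le]), which is
    bounded in d when sum_j gamma_j^(1/alpha) converges
    ([prod_decay_bound]).  Infinite sums over the frequencies are replaced
    throughout by bounds on all finite partial sums. *)

Local Notation zerov d := [tuple (0 : int) | _ < d].
Local Notation oppv k := [tuple - tnth k j | j < _].

(** * Trigonometric polynomials on the unit cube *)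

Section cube.
Context {R : realType}.
Implicit Types t : R.

Lemma periodic_int (f : R -> R) (T : R) : periodic f T ->
  forall (m : int) t, f (t + T * m%:~R) = f t.
Proof.
move=> fT [n|n] t; first by rewrite mulr_natr periodicn.
rewrite NegzE mulrNz mulrN mulr_natr.
by rewrite -[in RHS](subrK (T *+ n.+1) t) periodicn.
Qed.

Lemma cosD2piz t (m : int) : cos (t + 2 * pi * m%:~R) = cos t.
Proof. by rewrite mulr_natl periodic_int//; exact: cosD2pi. Qed.

Lemma sinD2piz t (m : int) : sin (t + 2 * pi * m%:~R) = sin t.
Proof. by rewrite mulr_natl periodic_int//; exact: sinD2pi. Qed.

Lemma measurable_phase (d : nat) (k : d.-tuple int) :
  measurable_fun [set: d.-tuple (measurableTypeR R)] (phase k).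
Proof.
apply: measurable_funM => //.
apply: measurable_sum => j; apply: measurable_funM => //.
exact: measurable_tnth.
Qed.

Lemma measurable_cosD (d : nat) (k : d.-tuple int) t :
  measurable_fun [set: d.-tuple (measurableTypeR R)]
    (fun x => cos (phase k x + t)).
Proof.
apply: (@measurableT_comp _ _ _ _ _ _ (@cos R)).
  by apply: continuous_measurable_fun; exact: continuous_cos.
by apply: measurable_funD => //; exact: measurable_phase.
Qed.

(** All integrands on the cube below are bounded and measurable. *)
Lemma bounded_integrable_prob d (T : measurableType d) (P : probability T R)
    (f : T -> R) (c : R) :
  measurable_fun setT f -> (forall x, `|f x| <= c) ->
  P.-integrable setT (EFin \o f).
Proof.
move=> mf fc; apply: measurable_bounded_integrable => //.
  by apply: le_lt_trans (ltry 1); rewrite -(probability_setT P).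
by exists c; split; [exact: num_real | move=> M cM x _; apply: le_trans (fc x) (ltW cM)].
Qed.

Lemma Rintegral_prob_cst d (T : measurableType d) (P : probability T R) (c : R) :
  \int[P]_x c = c.
Proof.
by rewrite Rintegral_cst// [X in fine X](probability_setT P) mulr1.
Qed.

Lemma integral_cos_unit (m : int) t :
  \int[uniform_prob (@ltr01 R)]_x (cos (2 * pi * m%:~R * x + t)) =
  if m == 0 then cos t else 0.
Proof.
have [->|m0] := eqVneq m 0.
  under eq_Rintegral do rewrite mulr0 mul0r add0r.
  exact: Rintegral_prob_cst.
set c : R := 2 * pi * m%:~R.
have c0 : c != 0.
  by rewrite /c mulf_neq0 ?intr_eq0// lt0r_neq0// mulr_gt0// pi_gt0.
have mcos : measurable_fun setT (fun x : R => cos (c * x + t)).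
  apply: (@measurableT_comp _ _ _ _ _ _ (@cos R)).
    by apply: continuous_measurable_fun; exact: continuous_cos.
  by apply: measurable_funD => //; apply: measurable_funM.
(* Adding 1 makes the integrand nonnegative. *)
suff H : (\int[uniform_prob (@ltr01 R)]_x (1 + cos (c * x + t))%:E = 1)%E.
  rewrite (_ : (fun x => _) = (fun x => (1 + cos (c * x + t)) - 1)); last first.
    by apply/funext => x; rewrite addrAC subrr add0r.
  rewrite RintegralB//=; first by rewrite Rintegral_prob_cst /Rintegral H subrr.
    apply: (@bounded_integrable_prob _ _ _ _ 2).
      exact: measurable_funD.
    by move=> x; rewrite (le_trans (ler_normD _ _))// normr1 lerD// cos_max.
  by apply: (@bounded_integrable_prob _ _ _ _ 1) => // x; rewrite normr1.
rewrite integral_uniform; last 2 first.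
- by apply/measurable_EFinP; apply: measurable_funD.
- by move=> x; rewrite lee_fin -lerBlDl sub0r cos_geN1.
rewrite subr0 invr1 mul1e.
have dF (x : R) : is_derive x 1 (fun x =>
    x + c^-1 * sin (c * x + t)) (1 + cos (c * x + t)).
  have dg : is_derive x 1 ((c \*: id) + cst t : R -> R) (c *: 1 + 0) by exact: is_deriveD.
  have ds : is_derive x 1 (sin \o ((c \*: id) + cst t)) (cos (c * x + t) * c).
    have := is_derive1_comp (is_derive_sin _) dg.
    by rewrite scaler1 addr0.
  have -> : 1 + cos (c * x + t) = 1 + c^-1 *: (cos (c * x + t) * c).
    by rewrite /GRing.scale/= mulrCA mulVf// mulr1.
  exact: (is_deriveD (is_derive_id _ _) (is_deriveZ _ ds)).
rewrite (@continuous_FTC2 _ _ (fun x => x + c^-1 * sin (c * x + t)))//.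
- rewrite -EFinB; congr EFin.
  rewrite mulr0 add0r mulr1.
  have -> : sin (c + t) = sin t; last by rewrite add0r addrK.
  by rewrite addrC /c sinD2piz.
- apply: continuous_subspaceT => x.
  apply: cvgD; first exact: cvg_cst.
  apply: continuous_comp; last exact: continuous_cos.
  apply: cvgD; last exact: cvg_cst.
  by apply: cvgM; [exact: cvg_cst|exact: cvg_id].
- have cF : continuous (fun x => x + c^-1 * sin (c * x + t)).
    move=> x; apply: differentiable_continuous; apply/derivable1_diffP.
    by have [] := dF x.
  split; [by move=> x _; have [] := dF x|..].
  + exact/cvg_at_right_filter/cF.
  + exact/cvg_at_left_filter/cF.
- by move=> x _; rewrite derive1E; have [] := dF x.
Qed.

Lemma phase0 (d : nat) (x : d.-tuple R) : phase (zerov d) x = 0.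
Proof.
by rewrite /phase big1 ?mulr0// => j _; rewrite tnth_mktuple mul0r.
Qed.

Lemma tnth_behead_lift (T : Type) (d : nat) (k : d.+1.-tuple T) (j : 'I_d) :
  tnth [tuple of behead k] j = tnth k (lift ord0 j).
Proof.
rewrite tnth_behead; congr tnth.
by apply: val_inj; rewrite /= inordK// ltnS.
Qed.

Lemma phase_cons (d : nat) (k : d.+1.-tuple int) (x : R) (y : d.-tuple R) :
  phase k (tuple_cons (x, y)) = 2 * pi * (thead k)%:~R * x + phase [tuple of behead k] y.
Proof.
rewrite /phase big_ord_recl mulrDr mulrA; congr (_ + _ * _).
by apply: eq_bigr => j _; rewrite tnth_behead_lift tnthS.
Qed.

Lemma eq_zerov_cons (d : nat) (k : d.+1.-tuple int) :
  (k == zerov d.+1) =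
  (thead k == 0) && ([tuple of behead k] == zerov d).
Proof.
apply/eqP/andP => [->|[/eqP h /eqP b]].
  split; apply/eqP; first by rewrite /thead tnth_mktuple.
  by apply: eq_from_tnth => j; rewrite tnth_behead_lift !tnth_mktuple.
apply: eq_from_tnth => j; rewrite tnth_mktuple.
case: (unliftP ord0 j) => [i|] ->; last by rewrite -[RHS]h.
have := congr1 (fun s => tnth s i) b.
by rewrite tnth_mktuple tnth_behead_lift.
Qed.

(** The phase shift t makes the induction on d go through: after integrating
    the last d coordinates the first one is left with a cosine of the same
    form. *)
Lemma integral_cos_cube (d : nat) (k : d.-tuple int) t :
  cube_integral (fun x => cos (phase k x + t)) =
  if k == zerov d then cos t else 0.
Proof.
rewrite /cube_integral /cube_measure.
elim: d k t => [|d IH] k t.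
  have -> : k == zerov 0 by apply/eqP/eq_from_tnth; case.
  rewrite /Rintegral.
  rewrite /= integral_dirac//; last by apply/measurable_EFinP; exact: measurable_cosD.
  by rewrite diracT mul1e /phase big_ord0 mulr0 add0r.
rewrite /= /Rintegral integral_distribution; last 2 first.
- by apply/measurable_EFinP; exact: measurable_cosD.
- apply: (@bounded_integrable_prob _ _ _ _ 1); last by move=> x; exact: cos_max.
  apply: measurableT_comp (@measurable_cosD _ k t) _.
  exact: measurable_tuple_cons.
set P1 := uniform_prob _; set P2 := power_prob _ _.
rewrite (_ : (_ \o _) = (fun z : measurableTypeR R * d.-tuple (measurableTypeR R) =>
   (cos (phase [tuple of behead k] z.2 + (2 * pi * (thead k)%:~R * z.1 + t)))%:E));
       last first.
  by apply/funext => -[x y] /=; rewrite phase_cons addrAC addrC addrA.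
rewrite /product_prob.
rewrite -(@integral12_prod_meas1 _ _ _ _ _ P1 P2); last first.
  apply: (@bounded_integrable_prob _ _ (product_prob P1 P2) _ 1); last by move=> x;
      exact: cos_max.
  apply: (@measurableT_comp _ _ _ _ _ _ (@cos R)).
    by apply: continuous_measurable_fun; exact: continuous_cos.
  apply: measurable_funD.
    exact: measurableT_comp (@measurable_phase _ _) _.
  apply: measurable_funD => //; apply: measurable_funM => //.
rewrite /fubini_F /=.
have E x : (\int[P2]_y (cos (phase [tuple of behead k] y + (2 * pi * (thead k)%:~R * x + t)))%:E =
    (if [tuple of behead k] == zerov d then cos (2 * pi * (thead k)%:~R * x + t) else 0)%:E)%E.
  rewrite -IH fineK//; apply: integrable_fin_num => //.
  apply: (@bounded_integrable_prob _ _ _ _ 1) => [|y]; last exact: cos_max.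
  exact: measurable_cosD.
under eq_integral do rewrite E.
rewrite eq_zerov_cons andbC; case: eqP => _ /=; last by rewrite integral0.
exact: integral_cos_unit.
Qed.

Definition subv (d : nat) (k l : d.-tuple int) : d.-tuple int :=
  [tuple tnth k j - tnth l j | j < d].

Lemma phase_subv (d : nat) (k l : d.-tuple int) (x : d.-tuple R) :
  phase (subv k l) x = phase k x - phase l x.
Proof.
rewrite /phase -mulrBr -sumrB; congr (_ * _).
by apply: eq_bigr => j _; rewrite tnth_mktuple rmorphB mulrBl.
Qed.

Lemma subv_eq_zerov (d : nat) (k l : d.-tuple int) :
  (subv k l == zerov d) = (k == l).
Proof.
apply/eqP/eqP => [h|->]; apply: eq_from_tnth => j; last by rewrite !tnth_mktuple subrr.
by have /eqP := congr1 (fun s => tnth s j) h; rewrite !tnth_mktuple subr_eq0 => /eqP.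
Qed.

(** Real trigonometric polynomials, indexed by I through K so that the same
    frequency may occur for several indices, as in the expansion of a square. *)
Definition trigpoly (d : nat) (I : Type) (s : seq I) (K : I -> d.-tuple int)
    (u v : I -> R) (x : d.-tuple R) : R :=
  \sum_(i <- s) (u i * cos (phase (K i) x) + v i * sin (phase (K i) x)).

Lemma measurable_trigterm (d : nat) (k : d.-tuple int) (a b : R) :
  measurable_fun [set: d.-tuple (measurableTypeR R)]
    (fun x => a * cos (phase k x) + b * sin (phase k x)).
Proof.
apply: measurable_funD; apply: measurable_funM => //.
  rewrite (_ : (fun x => _) = (fun x => cos (phase k x + 0))).
    exact: measurable_cosD.
  by apply/funext => x; rewrite addr0.
rewrite (_ : (fun x => _) = (fun x => cos (phase k x - pi / 2))).
  exact: measurable_cosD.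
by apply/funext => x; rewrite cosBpihalf.
Qed.

Lemma measurable_trigpoly (d : nat) (I : Type) (s : seq I)
    (K : I -> d.-tuple int) (u v : I -> R) :
  measurable_fun [set: d.-tuple (measurableTypeR R)] (trigpoly s K u v).
Proof. by apply: measurable_sum => i; exact: measurable_trigterm. Qed.

Lemma trigterm_bound (a b t : R) : `|a * cos t + b * sin t| <= `|a| + `|b|.
Proof.
rewrite (le_trans (ler_normD _ _))// !normrM lerD// -[leRHS]mulr1 ler_wpM2l//.
  exact: cos_max.
exact: sin_max.
Qed.

Lemma trigpoly_bound (d : nat) (I : Type) (s : seq I)
    (K : I -> d.-tuple int) (u v : I -> R) x :
  `|trigpoly s K u v x| <= \sum_(i <- s) (`|u i| + `|v i|).
Proof.
rewrite (le_trans (ler_norm_sum _ _ _))//; apply: ler_sum => i _.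
exact: trigterm_bound.
Qed.

Lemma integrable_trigpoly (d : nat) (I : Type) (s : seq I)
    (K : I -> d.-tuple int) (u v : I -> R) :
  (cube_measure R d).-integrable setT (EFin \o trigpoly s K u v).
Proof.
apply: bounded_integrable_prob; first exact: measurable_trigpoly.
exact: trigpoly_bound.
Qed.

Lemma integral_trigpoly (d : nat) (I : Type) (s : seq I)
    (K : I -> d.-tuple int) (u v : I -> R) :
  cube_integral (trigpoly s K u v) = \sum_(i <- s | K i == zerov d) u i.
Proof.
have icos k t : (cube_measure R d).-integrable setT (EFin \o (fun x =>
    cos (phase k x + t))).
  apply: (@bounded_integrable_prob _ _ _ _ 1) => [|x]; last exact: cos_max.
  exact: measurable_cosD.
have E k (a b : R) : (fun x : d.-tuple R => a * cos (phase k x) + b * sin (phase k x)) =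
    (fun x => a * cos (phase k x + 0) + b * cos (phase k x - pi / 2)).
  by apply/funext => x; rewrite addr0 cosBpihalf.
elim: s => [|i s IH].
  rewrite big_nil /cube_integral (_ : trigpoly _ _ _ _ = (fun=> 0)).
    exact: Rintegral_prob_cst.
  by apply/funext => x; rewrite /trigpoly big_nil.
have -> : trigpoly (i :: s) K u v =
    (fun x => trigpoly [:: i] K u v x + trigpoly s K u v x).
  by apply/funext => x; rewrite /trigpoly big_cons big_seq1.
rewrite /cube_integral RintegralD//; [|exact: integrable_trigpoly..].
rewrite -!/(cube_integral _) IH big_cons.
have -> : cube_integral (trigpoly [:: i] K u v) = if K i == zerov d then u i else 0.
  rewrite /trigpoly; under [X in cube_integral X]funext => x do rewrite big_seq1.
  rewrite E /cube_integral RintegralD//; last 2 first.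
  - rewrite (_ : _ \o _ = (fun x => (u i)%:E * (EFin \o (fun x =>
      cos (phase (K i) x + 0))) x)%E).
      by apply: integrableZl.
    by [].
  - rewrite (_ : _ \o _ = (fun x => (v i)%:E * (EFin \o (fun x =>
      cos (phase (K i) x - pi / 2))) x)%E).
      by apply: integrableZl.
    by [].
  rewrite !RintegralZl// -!/(cube_integral _) !integral_cos_cube.
  case: ifP => _; last by rewrite !mulr0 addr0.
  by rewrite cos0 cosN cos_pihalf mulr0 addr0 mulr1.
by case: ifP => // _; rewrite add0r.
Qed.

(** The integrand is at most its sum with the square of the conjugate
    polynomial. That sum is |g|^2 for the complex polynomial g with
    coefficients a - i b, whose expansion only involves differences of
    frequencies; these vanish on the diagonal only, so the integral of |g|^2
    is the sum of the |a - i b|^2. *)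
Lemma bessel_trigpoly (d : nat) (F : seq (d.-tuple int)) (a b : d.-tuple int -> R) :
  uniq F ->
  cube_integral (fun x => trigpoly F id a b x ^+ 2) <=
  \sum_(k <- F) (a k ^+ 2 + b k ^+ 2).
Proof.
move=> uF.
pose s := [seq (k, l) | k <- F, l <- F].
pose u (p : d.-tuple int * d.-tuple int) := a p.1 * a p.2 + b p.1 * b p.2.
pose v (p : d.-tuple int * d.-tuple int) := b p.1 * a p.2 - a p.1 * b p.2.
pose K (p : d.-tuple int * d.-tuple int) := subv p.1 p.2.
have HE x : trigpoly F id a b x ^+ 2 + trigpoly F id (fun k => - b k) a x ^+ 2 =
    trigpoly s K u v x.
  rewrite /trigpoly /s big_allpairs !expr2 !big_distrl /= -big_split /=.
  apply: eq_bigr => k _; rewrite !big_distrr /= -big_split /=.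
  apply: eq_bigr => l _; rewrite /K phase_subv cosB sinB /u /v /=.
  by ring.
have -> : \sum_(k <- F) (a k ^+ 2 + b k ^+ 2) = cube_integral (trigpoly s K u v).
  rewrite integral_trigpoly /s [RHS]big_mkcond big_allpairs big_seq [RHS]big_seq.
  apply: eq_bigr => k kF.
  under eq_bigr do rewrite /K subv_eq_zerov.
  rewrite -big_mkcond /= (eq_bigl (fun l => l == k)) => [|l]; last by rewrite eq_sym.
  by rewrite -big_filter filter_pred1_uniq// big_seq1 /u !expr2.
apply: le_Rintegral => //.
- apply: (@bounded_integrable_prob _ _ _ _ ((\sum_(i <- F) (`|a i| + `|b i|)) ^+ 2)).
    by apply: measurable_funX; exact: measurable_trigpoly.
  move=> x; rewrite normrX ler_pXn2r ?nnegrE//; first exact: trigpoly_bound.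
  by apply: sumr_ge0 => i _; rewrite addr_ge0.
- exact: integrable_trigpoly.
- by move=> x _; rewrite -HE lerDl sqr_ge0.
Qed.

End cube.

(** * Unordered sums of nonnegative terms *)

Section sums.
Context {R : realType} {T : choiceType}.
Implicit Types (c : T -> R) (a : T -> \bar R).

Lemma seq_le_esum a (s : seq T) : (forall k, 0 <= a k)%E -> uniq s ->
  (\sum_(k <- s) a k <= \esum_(k in [set: T]) a k)%E.
Proof.
move=> a0 us; rewrite fsbig_seq//; apply: esum_ge.
by exists [set` s] => //; split=> //; exact: finite_seq.
Qed.

Lemma esum_le_seq a (x : \bar R) : (forall k, 0 <= a k)%E ->
  (forall s : seq T, uniq s -> (\sum_(k <- s) a k <= x)%E) ->
  (\esum_(k in [set: T]) a k <= x)%E.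
Proof.
move=> a0 H; apply: ge_ereal_sup => _ [A [finA _] <-].
by rewrite fsbig_finite//= H.
Qed.

(** F is chosen with a partial sum within e of the total. *)
Lemma esum_tail c (e : R) : (forall k, 0 <= c k) ->
  (\esum_(k in [set: T]) (c k)%:E < +oo)%E -> 0 < e ->
  exists F : {fset T}, forall B : {fset T}, [disjoint B & F]%fset ->
    \sum_(k <- B) c k <= e.
Proof.
move=> c0 fin e0.
have c0' k : (0 <= (c k)%:E)%E by rewrite lee_fin.
have S0 : (0 <= \esum_(k in [set: T]) (c k)%:E)%E by exact: esum_ge0.
have Sfin : (\esum_(k in [set: T]) (c k)%:E)%E \is a fin_num by rewrite ge0_fin_numE.
have [_ [A [finA _] <-] hA] := ub_ereal_sup_adherent e0 Sfin.
exists (fset_set A) => B /fdisjointP BA.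
have us : uniq (fset_set A ++ B).
  rewrite cat_uniq !fset_uniq andbT /=; apply/hasPn => k kB.
  exact: BA.
have := seq_le_esum c0' us; move: hA.
rewrite -[ereal_sup _]/(\esum_(k in [set: T]) (c k)%:E)%E.
rewrite fsbig_finite//= big_cat/= -(fineK Sfin) !sumEFin -!EFinD lte_fin lee_fin.
by move=> h1 h2; rewrite -(lerD2l (\sum_(i <- fset_set A) c i)); lra.
Qed.

End sums.

(** * Uniform approximation by Fourier partial sums *)

Section approx.
Context {R : realType} {d : nat}.
Implicit Types (f : d.-tuple R -> R) (k : d.-tuple int).

(** The Fourier coefficient of f at k is coef_cos f k - i coef_sin f k. *)
Definition coef_cos f k : R := cube_integral (fun x => f x * cos (phase k x)).
Definition coef_sin f k : R := cube_integral (fun x => f x * sin (phase k x)).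

Lemma normc_fourier_coef f k :
  ComplexField.Normc.normc (fourier_coef f k) ^+ 2 =
      coef_cos f k ^+ 2 + coef_sin f k ^+ 2.
Proof.
rewrite /fourier_coef /= sqr_sqrtr ?addr_ge0 ?sqr_ge0// sqrrN//.
Qed.

Lemma ler_norm_Re (z : R[i]) : `|complex.Re z| <= ComplexField.Normc.normc z.
Proof.
by case: z => x y /=; rewrite -sqrtr_sqr ler_wsqrtr// lerDl sqr_ge0.
Qed.

Lemma Re_fourier_term f k x :
  complex.Re (fourier_coef f k * expi (phase k x)) =
  coef_cos f k * cos (phase k x) + coef_sin f k * sin (phase k x).
Proof. by rewrite /fourier_coef /expi /= mulNr opprK. Qed.

Lemma normc_expi t : ComplexField.Normc.normc (expi t : R[i]) = 1.
Proof. by rewrite /= cos2Dsin2 sqrtr1. Qed.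

(** The pointwise limit along finite sets becomes a uniform estimate because
    the tail of the Fourier series is dominated by the absolutely convergent
    sum of the |fhat(k)|. *)
Lemma korobov_approx alpha gam f (e : R) : korobov alpha gam f -> 0 < e ->
  exists F : {fset d.-tuple int}, forall B : {fset d.-tuple int}, (F `<=` B)%fset ->
  forall x, in_cube x -> `|f x - trigpoly B id (coef_cos f) (coef_sin f) x| <= e.
Proof.
move=> [_ fin cf _ _] e0.
have e20 : 0 < e / 2 by rewrite divr_gt0.
have c0 k : 0 <= ComplexField.Normc.normc (fourier_coef f k).
  by rewrite /= sqrtr_ge0.
have [F HF] := esum_tail c0 fin e20.
have approx x : in_cube x -> exists F0 : {fset d.-tuple int}, forall B, (F0 `<=` B)%fset ->
    `|f x - trigpoly B id (coef_cos f) (coef_sin f) x| <= e / 2.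
  move=> xc.
  have e2C : 0 < (e / 2)%:C%C by rewrite ltcR.
  have Ft : Filter (@summability.totally (d.-tuple int)).
    exact: @filter_filter _ _ (@summability.totally_filter _).
  have /cvgrPdist_le/(_ _ e2C)[F0 _ HF0] := cf x xc.
  exists F0 => B FB; have := HF0 B FB.
  rewrite /summability.partial_sum /=.
  rewrite -(big_seq_fsetE _ _ predT (fun k => fourier_coef f k * expi (phase k x))) /=.
  rewrite normc_def lecR => h; apply: le_trans h.
  set S := \sum_(i <- B) _.
  rewrite -sqrtr_sqr ler_wsqrtr// [complex.Re _]raddfB /=.
  rewrite (_ : trigpoly B _ _ _ x = complex.Re S) ?lerDl ?sqr_ge0//.
  rewrite /S raddf_sum /=; apply: eq_bigr => k _.
  by rewrite mulNr opprK.
exists F => B FB x xc; have [F0 HF0] := approx x xc.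
pose B0 := (B `|` F0)%fset.
have h1 := HF0 B0 (fsubsetUr _ _).
have -> : f x - trigpoly B id (coef_cos f) (coef_sin f) x =
  (f x - trigpoly B0 id (coef_cos f) (coef_sin f) x) +
  trigpoly (F0 `\` B)%fset id (coef_cos f) (coef_sin f) x.
  have pB : perm_eq B0 (B ++ (F0 `\` B)%fset).
    apply: uniq_perm; rewrite ?fset_uniq//.
      rewrite cat_uniq !fset_uniq andbT /=; apply/hasPn => k.
      by rewrite inE => /andP[].
    by move=> k; rewrite mem_cat !inE; case: (k \in B).
  by rewrite [in RHS]/trigpoly (perm_big _ pB) big_cat /= /trigpoly; ring.
rewrite (le_trans (ler_normD _ _))// [leRHS](splitr e) lerD//.
rewrite /trigpoly (le_trans (ler_norm_sum _ _ _))//.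
apply: le_trans (HF (F0 `\` B)%fset _); last first.
  apply/fdisjointP => k; rewrite inE => /andP[kB _].
  by apply: contra kB => /(fsubsetP FB).
apply: ler_sum => k _; rewrite -Re_fourier_term.
apply: le_trans (ler_norm_Re _) _.
by rewrite Normc.normcM normc_expi mulr1.
Qed.

End approx.

(** * Aliasing on rank-1 lattices *)

Section lattice.
Context {R : realType} {d : nat}.
Implicit Types (k : d.-tuple int).

Definition dotz (N : nat) k (z : d.-tuple 'I_N) : int :=
  \sum_(j < d) tnth k j * (tnth z j : nat)%:Z.

(** Reducing the coordinates modulo 1 changes k.x by an integer. *)
Lemma phase_frac k (y : 'I_d -> R) : exists m : int,
  phase k [tuple frac_part (y j) | j < d] =
  2 * pi * (\sum_(j < d) (tnth k j)%:~R * y j) + 2 * pi * m%:~R.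
Proof.
exists (- \sum_(j < d) tnth k j * Num.floor (y j)).
rewrite /phase -mulrDr; congr (_ * _).
rewrite rmorphN rmorph_sum -sumrB /=; apply: eq_bigr => j _.
by rewrite tnth_mktuple /frac_part mulrBr rmorphM.
Qed.

Lemma phase_lattice (N : nat) k (z : d.-tuple 'I_N) (n : 'I_N) : exists m : int,
  phase k (lattice_points (R := R) z n) =
  n%:R * (2 * pi * (dotz k z)%:~R / N%:R) + 2 * pi * m%:~R.
Proof.
have [m ->] := phase_frac k (fun j => n%:R * (tnth z j)%:R / N%:R).
exists m; congr (_ + _); rewrite /dotz rmorph_sum /= mulr_sumr mulr_sumr mulr_suml mulr_sumr.
apply: eq_bigr => j _; rewrite rmorphM /= -!pmulrn.
by ring.
Qed.

Lemma phase_shift (N : nat) k (P : 'I_N ->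
    d.-tuple R) (D : d.-tuple R) n : exists m : int,
  phase k (shift_points P D n) = phase k (P n) + phase k D + 2 * pi * m%:~R.
Proof.
have [m E] := phase_frac k (fun j => tnth (P n) j + tnth D j).
exists m; rewrite E; congr (_ + _); rewrite /phase -mulrDr -big_split /=.
by congr (_ * _); apply: eq_bigr => j _; rewrite mulrDr.
Qed.

Lemma frac_in_cube (y : 'I_d -> R) : in_cube [tuple frac_part (y j) | j < d].
Proof.
move=> j; rewrite tnth_mktuple /frac_part subr_ge0 floor_le_tmp/= lerBlDl.
by rewrite -[1]/(1%:~R) -intrD ltW// floorD1_gt// num_real.
Qed.

Lemma sin_piz (m : int) : sin (pi * m%:~R) = 0 :> R.
Proof.
have H n : sin (pi * n%:R) = 0 :> R.
  by rewrite mulr_natr -[_ *+ _]add0r alternatingn ?sin0 ?mulr0//; exact: sinDpi.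
by case: m => n; [exact: H | rewrite NegzE mulrNz mulrN sinN H oppr0].
Qed.

Lemma sin_pi_frac_neq0 (N : nat) (m : int) : (0 < N)%N -> ~~ (N %| m)%Z ->
  sin (pi * m%:~R / N%:R : R) != 0.
Proof.
move=> N0 Nm; apply/eqP => s0.
pose r := (m %% N)%Z; pose q := (m %/ N)%Z.
have mE : m = q * N + r by exact: divz_eq.
have r0 : 0 <= r by rewrite modz_ge0// -lt0n.
have rN : r < N by rewrite ltz_pmod.
have r1 : 0 < r.
  by rewrite lt_neqAle r0 andbT eq_sym; apply: contra Nm => /eqP h; apply/dvdz_mod0P.
have NR : (N%:R : R) != 0 by rewrite pnatr_eq0 -lt0n.
have : cos (2 * pi * r%:~R / N%:R : R) = 1.
  have <- : cos (2 * pi * m%:~R / N%:R : R) = cos (2 * pi * r%:~R / N%:R : R).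
    rewrite mE -[RHS](cosD2piz _ q); congr cos; rewrite rmorphD rmorphM /= -pmulrn.
    by field.
  rewrite (_ : 2 * pi * m%:~R / N%:R = (pi * m%:~R / N%:R) *+ 2);
      last by rewrite mulr2n; ring.
  by rewrite cos_mulr2n cos2sin2 s0 expr0n /= subr0; ring.
rewrite (_ : 2 * pi * r%:~R / N%:R = (pi * r%:~R / N%:R) *+ 2);
    last by rewrite mulr2n; ring.
have : 0 < sin (pi * r%:~R / N%:R : R).
  apply: sin_gt0_pi; rewrite divr_gt0 ?mulr_gt0 ?pi_gt0 ?ltr0z ?ltr0n//=.
  rewrite ltr_pdivrMr ?ltr0n// ltr_pM2l ?pi_gt0//.
  by rewrite (_ : N%:R = (N%:Z)%:~R)// ltr_int.
rewrite cos_mulr2n cos2sin2; move: (sin _) => u u0 h.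
have : u ^+ 2 = 0 by lra.
by move/eqP; rewrite sqrf_eq0 gt_eqF.
Qed.

(** Multiplying by 2 sin(h/2) makes the sum telescope. *)
Lemma sum_cos_arith (N : nat) (h t : R) : sin (h / 2) != 0 -> sin (N%:R * h / 2) = 0 ->
  \sum_(n < N) cos (n%:R * h + t) = 0.
Proof.
move=> s0 sN.
have s2 : 2 * sin (h / 2) != 0 by rewrite mulf_neq0.
apply: (mulfI s2); rewrite mulr0 mulr_sumr.
have E (n : nat) : 2 * sin (h / 2) * cos (n%:R * h + t) =
    sin (n.+1%:R * h + t - h / 2) - sin (n%:R * h + t - h / 2).
  have -> : n.+1%:R * h + t - h / 2 = (n%:R * h + t) + h / 2.
    by rewrite -natr1; field.
  by rewrite sinD sinB; ring.
under eq_bigr do rewrite E.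
rewrite -(big_mkord xpredT (fun n : nat =>
    sin (n.+1%:R * h + t - h / 2) - sin (n%:R * h + t - h / 2))).
rewrite (telescope_sumr (fun n : nat => sin (n%:R * h + t - h / 2)))//.
set A := N%:R * h / 2 + t - h / 2.
have -> : N%:R * h + t - h / 2 = A + N%:R * h / 2 by rewrite /A; field.
have -> : 0%:R * h + t - h / 2 = A - N%:R * h / 2 by rewrite /A mul0r add0r; ring.
by rewrite (sinD A) (sinB A) sN; ring.
Qed.

(** This is the character sum over the lattice: k.x runs through the
    multiples of k.z/N modulo 1, a geometric sum that vanishes unless N
    divides k.z. *)
Lemma sum_cos_lattice (N : nat) k (z : d.-tuple 'I_N) t : (0 < N)%N ->
  \sum_(n < N) cos (phase k (lattice_points (R := R) z n) + t) =
  if (N %| dotz k z)%Z then N%:R * cos t else 0.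
Proof.
move=> N0; have NR : (N%:R : R) != 0 by rewrite pnatr_eq0 -lt0n.
have E (n : 'I_N) : cos (phase k (lattice_points (R := R) z n) + t) =
    cos (n%:R * (2 * pi * (dotz k z)%:~R / N%:R) + t).
  by have [m ->] := phase_lattice k z n; rewrite addrAC cosD2piz.
under eq_bigr do rewrite E.
case: ifPn => [/dvdzP[q ->]|Nd]; last first.
  apply: sum_cos_arith.
    rewrite (_ : _ / 2 = pi * (dotz k z)%:~R / N%:R); last by field.
    exact: sin_pi_frac_neq0.
  rewrite (_ : _ / 2 = pi * (dotz k z)%:~R); last by field.
  exact: sin_piz.
under eq_bigr => n _.
  rewrite (_ : _ + t = t + 2 * pi * (n%:Z * q)%:~R) ?cosD2piz; last first.
    by rewrite !rmorphM /= -!pmulrn; field.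
  over.
by rewrite sumr_const card_ord mulr_natl.
Qed.

End lattice.

(** * Mean squared error under a random shift *)

Section errors.
Context {R : realType} {d : nat}.
Implicit Types (k : d.-tuple int) (f : d.-tuple R -> R).

(** Monotonicity for nonnegative functions that need not be measurable: the
    integral is a supremum over the simple functions below. It applies to the
    squared error of an arbitrary f of the space. *)
Lemma ge0_le_integral_any dT (T : measurableType dT) (mu : {measure set T -> \bar R})
    (f g : T -> \bar R) : (forall x, 0 <= f x)%E -> (forall x, f x <= g x)%E ->
  (\int[mu]_x f x <= \int[mu]_x g x)%E.
Proof.
move=> f0 fg; have g0 x : (0 <= g x)%E by exact: le_trans (f0 x) (fg x).
rewrite !ge0_integralTE//; apply: le_ereal_sup => _ [h hf <-].
by exists h => // x; exact: le_trans (hf x) (fg x).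
Qed.

(** A shifted lattice rule projects a trigonometric polynomial onto the
    frequencies of the dual lattice, and the shift becomes the variable. *)
Lemma qmc_shift_trigpoly (N : nat) (z : d.-tuple 'I_N) (D : d.-tuple R)
    (F : seq (d.-tuple int)) (a b : d.-tuple int -> R) : (0 < N)%N ->
  qmc (shift_points (lattice_points z) D) (trigpoly F id a b) =
  trigpoly [seq k <- F | (N %| dotz k z)%Z] id a b D.
Proof.
move=> N0; have NR : (N%:R : R) != 0 by rewrite pnatr_eq0 -lt0n.
rewrite /qmc /trigpoly exchange_big /= big_filter [RHS]big_mkcond mulr_sumr.
apply: eq_bigr => k _.
have Ec n : cos (phase k (shift_points (lattice_points z) D n)) =
    cos (phase k (lattice_points (R := R) z n) + phase k D).
  by have [m ->] := phase_shift k (lattice_points z) D n; rewrite cosD2piz.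
have Es n : sin (phase k (shift_points (lattice_points z) D n)) =
    cos (phase k (lattice_points (R := R) z n) + (phase k D - pi / 2)).
  have [m ->] := phase_shift k (lattice_points z) D n.
  by rewrite sinD2piz addrA cosBpihalf.
under eq_bigr do rewrite Ec Es.
rewrite big_split /= -!mulr_sumr !sum_cos_lattice//.
case: ifP => _; last by rewrite !mulr0 addr0 mulr0.
by rewrite cosBpihalf; field.
Qed.

Lemma qmc_trigpoly (N : nat) (z : d.-tuple 'I_N)
    (F : seq (d.-tuple int)) (a b : d.-tuple int -> R) : (0 < N)%N ->
  qmc (lattice_points z) (trigpoly F id a b) =
  \sum_(k <- F | (N %| dotz k z)%Z) a k.
Proof.
move=> N0; have NR : (N%:R : R) != 0 by rewrite pnatr_eq0 -lt0n.
rewrite /qmc /trigpoly exchange_big /= [RHS]big_mkcond mulr_sumr.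
apply: eq_bigr => k _.
have Ec n : cos (phase k (lattice_points z n)) = cos (phase k (lattice_points (R :=
    R) z n) + 0).
  by rewrite addr0.
have Es n : sin (phase k (lattice_points z n)) =
    cos (phase k (lattice_points (R := R) z n) - pi / 2).
  by rewrite cosBpihalf.
under eq_bigr do rewrite Ec Es.
rewrite big_split /= -!mulr_sumr !sum_cos_lattice//.
case: ifP => _; last by rewrite !mulr0 addr0 mulr0.
by rewrite cos0 cosN cos_pihalf; field.
Qed.

Lemma coef_cos0 f : coef_cos f (zerov d) = cube_integral f.
Proof.
by rewrite /coef_cos; under [X in cube_integral X]funext =>
    x do rewrite phase0 cos0 mulr1.
Qed.

Lemma qmc_close (N : nat) (P : 'I_N -> d.-tuple R) f g (e : R) : (0 < N)%N ->
  (forall n, `|f (P n) - g (P n)| <= e) -> `|qmc P f - qmc P g| <= e.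
Proof.
move=> N0 h; rewrite /qmc -mulrBr -sumrB normrM ger0_norm ?invr_ge0//.
rewrite ler_pdivrMl ?ltr0n//.
apply: le_trans (ler_norm_sum _ _ _) _.
apply: le_trans (ler_sum _ (fun n _ => h n)) _.
by rewrite sumr_const card_ord mulr_natl.
Qed.

(** Frequency 0 always lies in the dual lattice; its coefficient is the
    integral of f. *)
Lemma perm_dual_lattice (N : nat) (z : d.-tuple 'I_N) (F : {fset d.-tuple int}) :
  zerov d \in F ->
  perm_eq [seq k <- F | (N %| dotz k z)%Z]
   ((zerov d) :: [seq k <- F | (k != zerov d) && (N %| dotz k z)%Z]).
Proof.
move=> F0; apply: uniq_perm.
- by rewrite filter_uniq// fset_uniq.
- by rewrite /= filter_uniq ?fset_uniq// mem_filter eqxx.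
move=> k; rewrite inE !mem_filter; case: eqVneq => [->|//] /=.
rewrite F0 /dotz big1 ?dvdz0// => j _; by rewrite tnth_mktuple mul0r.
Qed.

(** Replacing f by a Fourier partial sum with uniform error e leaves a
    trigonometric polynomial T in the shift with frequencies in the dual
    lattice without 0, and Bessel applies. The factor 1 + e absorbs the cross
    term between T and the error. The finite set F does not depend on the
    rule. *)
Lemma shifted_error_bound alpha gam f (e : R) : korobov alpha gam f -> 0 < e ->
  exists F : {fset d.-tuple int}, forall (N : nat) (z : d.-tuple 'I_N), (0 < N)%N ->
  (\int[cube_measure R d]_D
      (`|cube_integral f - qmc (shift_points (lattice_points z) D) f| ^+ 2)%:E <=
   ((1 + e) * (\sum_(k <- F | (k != zerov d) && (N %| dotz k z)%Z)
      (coef_cos f k ^+ 2 + coef_sin f k ^+ 2) + e))%:E)%E.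
Proof.
move=> kf e0; have [F0 HF0] := korobov_approx kf e0.
pose F := (F0 `|` [fset zerov d])%fset; exists F => N z N0.
set s := [seq k <- F | (k != zerov d) && (N %| dotz k z)%Z].
pose T := trigpoly s id (coef_cos f) (coef_sin f).
have HE D : `|cube_integral f - qmc (shift_points (lattice_points z) D) f| ^+ 2 <=
    (1 + e) * (T D ^+ 2 + e).
  set E := _ - _.
  have : `|E + T D| <= e.
    have := qmc_close (P := shift_points (lattice_points z) D) (g :=
        trigpoly F id (coef_cos f) (coef_sin f)) N0
      (fun n => HF0 F (fsubsetUl _ _) _ (frac_in_cube _)).
    rewrite qmc_shift_trigpoly// {1}/trigpoly (perm_big _ (perm_dual_lattice z _));
        last first.
      by rewrite !inE eqxx orbT.
    rewrite big_cons -/(trigpoly s id _ _ D) phase0 cos0 sin0 mulr1 mulr0 addr0 coef_cos0.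
    by rewrite /= -normrN opprB /E /T addrAC.
  rewrite ler_norml => /andP[h1 h2].
  rewrite real_normK ?num_real//.
  (* These products certify the inequality: with u = E + T D in [-e, e], the
     identity below writes the difference of the two sides as ((e+u)(T+1)^2 +
     (e-u)(T-1)^2)/2 + (e-u)(e+u). *)
  have p1 : 0 <= (e + (E + T D)) * (T D + 1) ^+ 2 by rewrite mulr_ge0 ?sqr_ge0//; lra.
  have p2 : 0 <= (e - (E + T D)) * (T D - 1) ^+ 2 by rewrite mulr_ge0 ?sqr_ge0//; lra.
  have p3 : 0 <= (e - (E + T D)) * (e + (E + T D)) by rewrite mulr_ge0//; lra.
  rewrite -subr_ge0.
  have -> : (1 + e) * (T D ^+ 2 + e) - E ^+ 2 =
    ((e + (E + T D)) * (T D + 1) ^+ 2 + (e - (E + T D)) * (T D - 1) ^+ 2) / 2 +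
    (e - (E + T D)) * (e + (E + T D)) by field.
  by rewrite addr_ge0// divr_ge0// addr_ge0.
apply: le_trans (ge0_le_integral_any (cube_measure R d) (g :=
    fun D => ((1 + e) * (T D ^+ 2 + e))%:E) _ _) _.
- by move=> D; rewrite lee_fin sqr_ge0.
- by move=> D; rewrite lee_fin.
have iT : (cube_measure R d).-integrable setT (EFin \o (fun D => T D ^+ 2)).
  apply: (@bounded_integrable_prob _ _ _ _ _ ((\sum_(i <- s) (`|coef_cos f i| + `|coef_sin f i|)) ^+ 2)).
    by apply: measurable_funX; exact: measurable_trigpoly.
  move=> x; rewrite normrX ler_pXn2r ?nnegrE//; first exact: trigpoly_bound.
  by apply: sumr_ge0 => i _; rewrite addr_ge0.
have ic : (cube_measure R d).-integrable setT (EFin \o (fun D => e)).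
  by apply: (@bounded_integrable_prob _ _ _ _ _ e) => // x; rewrite ger0_norm// ltW.
have iTe : (cube_measure R d).-integrable setT (EFin \o (fun D => T D ^+ 2 + e)).
  by rewrite (_ : _ \o _ = (fun D => (EFin \o (fun D =>
      (T D ^+ 2)%R)) D + (EFin \o (fun D => e)) D)%E)//; exact: integrableD.
have -> : (\int[cube_measure R d]_D ((1 + e) * (T D ^+ 2 + e))%:E =
    (\int[cube_measure R d]_D ((1 + e) * (T D ^+ 2 + e)))%:E)%E.
  rewrite /Rintegral fineK//; apply: integrable_fin_num => //.
  rewrite (_ : (fun D => _) = (fun D => (1 + e)%:E * (EFin \o (fun D =>
      (T D ^+ 2 + e)%R)) D)%E)//.
  exact: integrableZl.
rewrite lee_fin RintegralZl// ler_wpM2l//; first by rewrite addr_ge0// ltW.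
rewrite RintegralD// Rintegral_prob_cst lerD2r -big_filter.
by apply: bessel_trigpoly; rewrite filter_uniq// fset_uniq.
Qed.

End errors.

(** * Weights and the worst-case error *)

Lemma sum_delta (V : pzRingType) (T : eqType) (s : seq T) (k : T) (g : T -> V) : uniq s ->
  \sum_(i <- s) (i == k)%:R * g i = (k \in s)%:R * g k.
Proof.
move=> us; have [ks|ks] := boolP (k \in s); last first.
  rewrite mul0r big_seq big1// => i; case: eqVneq => [->|_ _]; last by rewrite mul0r.
  by rewrite (negbTE ks).
rewrite (bigD1_seq k)//= eqxx big1 ?addr0// => i /negbTE ->.
by rewrite mul0r.
Qed.

Section weights.
Context {R : realType} {d : nat} (alpha : R) (gam : nat -> R).
Hypothesis alpha0 : 0 < alpha.
Hypothesis hgam : forall j, 0 <= gam j <= 1.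
Implicit Types (k : d.-tuple int) (f : d.-tuple R -> R).

Definition decay_factor (j : nat) (m : int) : R :=
  if m == 0 then 1 else gam j / (`|m%:~R| `^ alpha).

(** The reciprocal of the weight r(k), equal to 0 where r(k) is infinite.
    Unlike r(k) it is a real number in [0, 1]. *)
Definition decay k : R := \prod_(j < d) decay_factor j (tnth k j).

Lemma decay_factor_ge0 j m : 0 <= decay_factor j m.
Proof.
rewrite /decay_factor; case: ifP => // _.
by rewrite divr_ge0 ?powR_ge0//; case/andP: (hgam j).
Qed.

Lemma normz_ge1 (m : int) : m != 0 -> 1 <= `|m%:~R : R|.
Proof.
by move=> m0; rewrite -intr_norm -[1]/(1%:~R) ler_int -gtz0_ge1 normr_gt0.
Qed.

Lemma decay_factor_powR j (m : int) : m != 0 ->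
    decay_factor j m <= (`|m%:~R| `^ alpha)^-1.
Proof.
move=> m0; rewrite /decay_factor (negbTE m0) ler_piMl// ?invr_ge0 ?powR_ge0//.
by case/andP: (hgam j).
Qed.

Lemma decay_factor_le1 j m : decay_factor j m <= 1.
Proof.
have [->|m0] := eqVneq m 0; first by rewrite /decay_factor eqxx.
apply: le_trans (decay_factor_powR j m0) _.
have h := normz_ge1 m0.
rewrite invf_le1 ?powR_gt0 ?(lt_le_trans _ h)//.
by rewrite -[leLHS](powRr0 `|m%:~R|) ler_powR// ltW.
Qed.

Lemma decay_ge0 k : 0 <= decay k.
Proof. by apply: prodr_ge0 => j _; exact: decay_factor_ge0. Qed.

Lemma decay_le1 k : decay k <= 1.
Proof.
by rewrite /decay prodr_ile1// => j _; rewrite decay_factor_ge0 decay_factor_le1.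
Qed.

Lemma decay_le_factor k (j : 'I_d) : decay k <= decay_factor j (tnth k j).
Proof.
rewrite /decay (bigD1 j)//= ler_piMr ?decay_factor_ge0//.
by rewrite prodr_ile1// => i _; rewrite decay_factor_ge0 decay_factor_le1.
Qed.

Lemma weight_rE k :
  weight_r alpha gam k = if decay k == 0 then +oo%E else ((decay k)^-1)%:E.
Proof.
rewrite /weight_r /decay big_mkcond.
pose Q (x : \bar R) (y : R) := 0 <= y /\ x = if y == 0 then +oo%E else (y^-1)%:E.
set b := (X in X = _).
suff : Q b (\prod_(j < d) decay_factor j (tnth k j)) by case.
rewrite {}/b; apply: big_ind2; first by split=> //; rewrite oner_eq0 invr1.
  move=> x1 x2 y1 y2 [hx2 ->] [hy2 ->]; split; first exact: mulr_ge0.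
  rewrite mulf_eq0; case: eqVneq => x0; case: eqVneq => y0 //=.
  - by rewrite gt0_mulye// lte_fin invr_gt0 lt_neqAle eq_sym y0.
  - by rewrite gt0_muley// lte_fin invr_gt0 lt_neqAle eq_sym x0.
  - by rewrite -EFinM invfM.
move=> j _; split; first exact: decay_factor_ge0.
rewrite /decay_factor; have [->|m0] := eqVneq (tnth k j) 0;
    first by rewrite oner_eq0 invr1.
have P0 : `|(tnth k j)%:~R| `^ alpha != 0 :> R.
  by rewrite gt_eqF// powR_gt0// (lt_le_trans _ (normz_ge1 m0)).
rewrite /= mulf_eq0 invr_eq0 (negbTE P0) orbF.
by case: ifP => // _; rewrite invfM invrK mulrC.
Qed.

(** The k-th term of the squared norm of f. Where decay k = 0 the division by
    0 gives 0, in agreement with the vanishing of the Fourier coefficient. *)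
Definition energy f k : R := (coef_cos f k ^+ 2 + coef_sin f k ^+ 2) / decay k ^+ 2.

Lemma energy_ge0 f k : 0 <= energy f k.
Proof. by rewrite divr_ge0 ?sqr_ge0// addr_ge0// sqr_ge0. Qed.

Lemma energyE f k : korobov alpha gam f ->
  coef_cos f k ^+ 2 + coef_sin f k ^+ 2 = decay k ^+ 2 * energy f k.
Proof.
move=> [_ _ _ h _]; rewrite /energy; have [d0|d0] := eqVneq (decay k) 0.
  rewrite d0 expr0n mul0r.
  have := h k; rewrite weight_rE d0 eqxx => /(_ erefl) E.
  by rewrite -normc_fourier_coef E /= expr0n addr0 sqrtr0 expr0n.
by rewrite mulrC divfK// sqrf_eq0.
Qed.

Lemma energy_sum f (s : seq (d.-tuple int)) : korobov_ball alpha gam f -> uniq s ->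
  \sum_(k <- s) energy f k <= 1.
Proof.
move=> [kf nf] us; have [_ _ _ h _] := kf.
rewrite -lee_fin -sumEFin.
have g0 k : (0 <= (Normc.normc (fourier_coef f k) ^+ 2)%:E * weight_r alpha gam k ^+ 2)%E.
  by rewrite mule_ge0// ?lee_fin ?sqr_ge0// sqre_ge0.
apply: le_trans (le_trans (seq_le_esum g0 us) _).
  apply: lee_sum => k _; rewrite weight_rE normc_fourier_coef.
  case: eqVneq => d0; last first.
    by rewrite /energy -EFin_expe -EFinM exprVn.
  by rewrite /energy d0 expr0n invr0 mulr0 mule_ge0// ?lee_fin ?addr_ge0 ?sqr_ge0//
      sqre_ge0.
move: nf; rewrite /korobov_norm.
set S := esum _ _ => nf.
have S0 : (0 <= S)%E by exact: esum_ge0.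
case: S S0 nf => [r| |] //=.
  rewrite !lee_fin => r0 h1.
  by move: h1; rewrite powR12_sqrt// -[leRHS]sqrtr1 ler_sqrt.
by rewrite invr_eq0 pnatr_eq0.
Qed.

(** The error is the sum of the Fourier coefficients over the dual lattice
    without 0, up to approximation, and each is bounded by (B w(k) + rho(k)^2
    / B) / 2 with w = energy f. Summing gives Cauchy-Schwarz in the form that
    is needed. *)
Lemma wce_le (N : nat) (z : d.-tuple 'I_N) (B : R) : (0 < N)%N -> 0 < B ->
  (forall s : seq (d.-tuple int), uniq s ->
     \sum_(k <- s | (k != zerov d) && (N %| dotz k z)%Z) decay k ^+ 2 <= B ^+ 2) ->
  (wce alpha gam (lattice_points (R := R) z) <= B%:E)%E.
Proof.
move=> N0 B0 HB; apply: ge_ereal_sup => _ [f bf <-].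
have [kf _] := bf.
rewrite lee_fin; apply/ler_addgt0Pr => e e0.
have [F0 HF0] := korobov_approx kf e0.
pose F := (F0 `|` [fset zerov d])%fset.
have := qmc_close (P := lattice_points z) (g :=
    trigpoly F id (coef_cos f) (coef_sin f)) N0
      (fun n => HF0 F (fsubsetUl _ _) _ (frac_in_cube _)).
rewrite qmc_trigpoly// -big_filter (perm_big _ (perm_dual_lattice z _)); last first.
  by rewrite !inE eqxx orbT.
rewrite big_cons /= coef_cos0 big_filter.
set S := \sum_(i <- F | _) _ => h.
have hS : `|S| <= B.
  apply: le_trans (ler_norm_sum _ _ _) _.
  apply: (@le_trans _ _ (\sum_(i <- F | (i != zerov d) && (N %| dotz i z)%Z)
     (2^-1 * (B * energy f i + decay i ^+ 2 / B)))).
    apply: ler_sum => k _.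
    have H0 : 0 <= 2^-1 * (B * energy f k + decay k ^+ 2 / B).
      apply: mulr_ge0 => //; apply: addr_ge0.
        by apply: mulr_ge0; [exact: ltW|exact: energy_ge0].
      by apply: divr_ge0; [exact: sqr_ge0|exact: ltW].
    rewrite -ler_sqr ?nnegrE// real_normK ?num_real//.
    apply: (@le_trans _ _ (decay k ^+ 2 * energy f k)).
      by rewrite -energyE// lerDl sqr_ge0.
    rewrite -subr_ge0.
    have -> : (2^-1 * (B * energy f k + decay k ^+ 2 / B)) ^+ 2 - decay k ^+ 2 * energy f k =
      (2^-1 * (B * energy f k - decay k ^+ 2 / B)) ^+ 2.
      by field; rewrite gt_eqF.
    exact: sqr_ge0.
  rewrite -mulr_sumr big_split /= -mulr_sumr -mulr_suml.
  have h1 : \sum_(i <- F | (i != zerov d) && (N %| dotz i z)%Z) energy f i <= 1.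
    by rewrite -big_filter energy_sum// filter_uniq// fset_uniq.
  have h2 := HB F (fset_uniq _).
  rewrite ler_pdivrMl// mulr_natl mulr2n lerD//.
    by rewrite ler_piMr// ltW.
  by rewrite ler_pdivrMr// -expr2.
apply: le_trans (lerD hS h).
have -> : cube_integral f - qmc (lattice_points z) f =
  - (S + (qmc (lattice_points z) f - (cube_integral f + S))) by ring.
rewrite normrN.
exact: ler_normD.
Qed.

Lemma neq_oppv k : k != zerov d -> k != oppv k.
Proof.
apply: contra => /eqP h; apply/eqP/eq_from_tnth => j.
have := congr1 (fun s => tnth s j) h; rewrite !tnth_mktuple => /eqP.
by rewrite -subr_eq0 opprK -mulr2n -mulr_natr mulf_eq0 orbF => /eqP.
Qed.

Lemma decay_opp k : decay (oppv k) = decay k.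
Proof.
apply: eq_bigr => j _; rewrite tnth_mktuple /decay_factor oppr_eq0.
by rewrite rmorphN normrN.
Qed.

Lemma phase_opp k (x : d.-tuple R) : phase (oppv k) x = - phase k x.
Proof.
rewrite /phase -mulrN -sumrN; congr (_ * _); apply: eq_bigr => j _.
by rewrite tnth_mktuple rmorphN mulNr.
Qed.

(** The test function rho(k) cos(2 pi k.x). Its two Fourier coefficients
    rho(k)/2 at k and - k give it a squared norm of at most 1/2. *)
Definition wave k : d.-tuple R -> R := trigpoly [:: k] id (fun=> decay k) (fun=> 0).

Lemma waveE k x : wave k x = decay k * cos (phase k x).
Proof. by rewrite /wave /trigpoly big_seq1 mul0r addr0. Qed.

Lemma wave_coef k l :
  (coef_cos (wave k) l = decay k / 2 * ((l == k)%:R + (l == oppv k)%:R)) *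
  (coef_sin (wave k) l = 0).
Proof.
pose K (b : bool) := subv l (if b then k else (oppv k)).
have PK b (x : d.-tuple R) : phase (K b) x =
    if b then phase l x - phase k x else phase l x + phase k x.
  by rewrite phase_subv; case: b => //=; rewrite phase_opp opprK.
split.
  rewrite /coef_cos.
  rewrite (_ : (fun x => _) = trigpoly [:: true;
      false] K (fun=> decay k / 2) (fun=> 0)); last first.
    apply/funext => x; rewrite /trigpoly !big_cons big_nil !PK waveE cosB cosD.
    by field.
  rewrite integral_trigpoly !big_cons big_nil !subv_eq_zerov.
  by case: eqP; case: eqP => _ _; rewrite /= ?(mulr0, addr0, mulr1, add0r, mulrDr).
rewrite /coef_sin.
rewrite (_ : (fun x => _) = trigpoly [:: true;
    false] K (fun=> 0) (fun=> decay k / 2)); last first.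
  apply/funext => x; rewrite /trigpoly !big_cons big_nil !PK waveE sinB sinD.
  by field.
by rewrite integral_trigpoly big1.
Qed.

Lemma wave_periodic k : one_periodic (wave k).
Proof.
move=> x j; rewrite !waveE; congr (_ * _).
rewrite -[RHS](cosD2piz _ (tnth k j)); congr cos; rewrite /phase -mulrDr; congr (_ * _).
rewrite [LHS](bigD1 j)//= [in RHS](bigD1 j)//= tnth_mktuple eqxx mulrDr mulr1 addrAC;
    congr (_ + _ + _).
by apply: eq_bigr => i ij; rewrite tnth_mktuple (negbTE ij) addr0.
Qed.

Lemma normc_wave k l : Normc.normc (fourier_coef (wave k) l) =
  decay k / 2 * ((l == k)%:R + (l == oppv k)%:R).
Proof.
rewrite /= -!/(coef_cos _ _) -!/(coef_sin _ _) !wave_coef oppr0 expr0n addr0 sqrtr_sqr ger0_norm//.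
by rewrite mulr_ge0 ?divr_ge0 ?decay_ge0// addr_ge0.
Qed.

Lemma sum_pair k (s : seq (d.-tuple int)) : uniq s ->
  \sum_(l <- s) ((l == k)%:R + (l == oppv k)%:R) <= 2 :> R.
Proof.
move=> us; rewrite big_split /= (_ : 2 = 1 + 1)// lerD//.
  under eq_bigr do rewrite -[_%:R]mulr1.
  by rewrite (sum_delta _ (fun=> 1))// mulr1 lern1; case: (_ \in _).
under eq_bigr do rewrite -[_%:R]mulr1.
by rewrite (sum_delta _ (fun=> 1))// mulr1 lern1; case: (_ \in _).
Qed.

Lemma fourier_wave k l : fourier_coef (wave k) l =
  ((decay k / 2 * ((l == k)%:R + (l == oppv k)%:R))%:C)%C.
Proof.
by rewrite /fourier_coef -!/(coef_cos _ _) -!/(coef_sin _ _) !wave_coef oppr0.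
Qed.

Lemma wave_in_ball k : k != zerov d -> korobov_ball alpha gam (wave k).
Proof.
move=> k0; set k' := oppv k.
have kk' : k != k' by exact: neq_oppv.
have Hn : (korobov_norm alpha gam (wave k) <= 1)%E.
  rewrite /korobov_norm; set S := esum _ _.
  have S1 : (S <= 1)%E.
    have term l : ((Normc.normc (fourier_coef (wave k) l) ^+ 2)%:E * weight_r alpha gam l ^+ 2 <=
        (2^-1 * ((l == k)%:R + (l == k')%:R))%:E)%E.
      have E (c : R) : decay l = decay k -> c = 1 -> 
         (((decay k / 2 * c) ^+ 2)%:E * weight_r alpha gam l ^+ 2 <= (2^-1 * c)%:E)%E.
        move=> dl ->; rewrite weight_rE dl; case: eqVneq => d0.
          by rewrite d0 !mul0r expr0n mul0e lee_fin mulr1.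
        rewrite -EFin_expe -EFinM lee_fin !mulr1.
        rewrite (_ : _ * _ = 2^-1 ^+ 2); last by field.
        by rewrite expr2 ler_piMl// invf_le1// ler1n.
      rewrite normc_wave -/k'; have [lk|lk] := boolP (l == k).
        have dl : decay l = decay k by rewrite (eqP lk).
        by apply: E => //; rewrite (eqP lk) (negbTE kk') addr0.
      have [lk'|lk'] := boolP (l == k'); last by rewrite addr0 !mulr0 expr0n mul0e.
      have dl : decay l = decay k by rewrite (eqP lk') decay_opp.
      by apply: E => //; rewrite add0r.
    apply: esum_le_seq => [l|s us].
      by rewrite mule_ge0// ?lee_fin ?sqr_ge0// sqre_ge0.
    apply: le_trans (lee_sum _ (fun l _ => term l)) _.
    rewrite sumEFin lee_fin -mulr_sumr ler_pdivrMl// mulr1.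
    exact: sum_pair.
  have S0 : (0 <= S)%E.
    by apply: esum_ge0 => l _; rewrite mule_ge0// ?lee_fin ?sqr_ge0// sqre_ge0.
  rewrite -(poweR1r 2^-1); apply: gt0_ler_poweR => //.
    by rewrite in_itv /= S0 leey.
  by rewrite in_itv /= lee01 leey.
split=> //; split.
- exact: wave_periodic.
- apply: (@le_lt_trans _ _ 1%E); last exact: ltry.
  apply: esum_le_seq => [l|s us];
      first by rewrite lee_fin normc_wave mulr_ge0 ?divr_ge0 ?decay_ge0// addr_ge0.
  rewrite sumEFin lee_fin; under eq_bigr do rewrite normc_wave.
  rewrite -mulr_sumr.
  apply: le_trans (ler_wpM2l _ (sum_pair k us)) _; first by rewrite divr_ge0 ?decay_ge0.
  by rewrite divfK// decay_le1.
- move=> x _; apply: cvg_near_cst.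
    exact: @filter_filter _ _ (@summability.totally_filter _).
  exists [fset k; k']%fset => // F /=.
  rewrite fsubUset !fsub1set => /andP[kF k'F].
  rewrite /summability.partial_sum /=.
  rewrite -(big_seq_fsetE _ _ predT (fun l =>
      fourier_coef (wave k) l * expi (phase l x))) /=.
  have E l : fourier_coef (wave k) l * expi (phase l x) =
     ((decay k / 2)%:C)%C * ((l == k)%:R * expi (phase l x) + (l == k')%:R * expi (phase l x)).
    by rewrite fourier_wave rmorphM rmorphD /= !rmorph_nat -mulrA mulrDl.
  under eq_bigr do rewrite E.
  rewrite -mulr_sumr big_split /= !sum_delta ?fset_uniq// kF k'F !mul1r.
  rewrite waveE phase_opp /expi cosN sinN; apply/eqP; rewrite eq_complex /=.
  by apply/andP; split; apply/eqP; field.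
- move=> l; rewrite weight_rE; case: eqVneq => // d0 _.
  rewrite fourier_wave.
  have H c : decay l = decay k -> ((decay k / 2 * c)%:C = 0 :> R[i])%C.
    by move=> dl; rewrite -dl d0 !mul0r.
  case: eqVneq => [lk|lk]; first by rewrite H// lk.
  by case: eqVneq => [lk'|lk']; [rewrite H// lk' decay_opp | rewrite addr0 mulr0].
- by apply: le_lt_trans Hn _; exact: ltry.
Qed.

(** The lattice rule takes the constant value 1 on cos(2 pi k.x) when N
    divides k.z, whereas the integral vanishes. *)
Lemma decay_le_wce (N : nat) (z : d.-tuple 'I_N) k : (0 < N)%N ->
  k != zerov d -> (N %| dotz k z)%Z ->
  ((decay k)%:E <= wce alpha gam (lattice_points (R := R) z))%E.
Proof.
move=> N0 k0 Nk; apply: ereal_sup_ubound; exists (wave k); first exact: wave_in_ball.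
rewrite integral_trigpoly qmc_trigpoly// !big_cons !big_nil (negbTE k0) Nk.
by rewrite addr0 sub0r normrN ger0_norm// decay_ge0.
Qed.

End weights.

(** * Primes between n and 2n *)

Section chebyshev.
Local Open Scope nat_scope.

Lemma prod_primes_dvd (s : seq nat) (x : nat) : uniq s -> all prime s ->
  (forall p, p \in s -> p %| x) -> \prod_(p <- s) p %| x.
Proof.
elim: s => [|p s IH] /=; first by rewrite big_nil dvd1n.
move=> /andP[ps us] /andP[pp als] H; rewrite big_cons Gauss_dvd.
  rewrite H ?mem_head//= IH// => q qs.
  by apply: H; rewrite inE qs orbT.
rewrite big_seq; elim/big_ind: _ => [|a b|q qs]; first exact: coprimen1.
  by move=> ? ?; rewrite coprimeMr; apply/andP.
rewrite prime_coprime// dvdn_prime2// ?(allP als)//.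
by apply: contra ps => /eqP ->.
Qed.

(** The binomial coefficients of 2m+1 at m and m+1 are equal, and their sum
    is at most 2^(2m+1). *)
Lemma bin_odd_le (m : nat) : 'C(m.*2.+1, m) <= 4 ^ m.
Proof.
have h : 'C(m.*2.+1, m) + 'C(m.*2.+1, m.+1) <= 2 ^ m.*2.+1.
  rewrite -[2]/(1 + 1) expnDn.
  have hm : m < m.*2.+2 by lia.
  have hm1 : m.+1 < m.*2.+2 by lia.
  rewrite (bigD1 (Ordinal hm))//= (bigD1 (Ordinal hm1)) /=; last first.
    by apply/eqP => /(congr1 val) /=; lia.
  by rewrite !exp1n !muln1 addnA leq_addr.
have e : 'C(m.*2.+1, m.+1) = 'C(m.*2.+1, m).
  by rewrite -bin_sub; [congr binomial; lia|lia].
move: h; rewrite e expnS (_ : 4 ^ m = 2 ^ m.*2); first lia.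
by rewrite -mul2n expnM.
Qed.

Lemma prime_dvd_fact (p n : nat) : prime p -> p %| n`! -> p <= n.
Proof.
move=> pp; elim: n => [|n IH].
  by rewrite fact0 dvdn1 => /eqP p1; rewrite p1 in pp.
rewrite factS Euclid_dvdM// => /orP[/dvdn_leq->//|/IH]; exact: leqW.
Qed.

(** The induction halves an odd number n = 2m+1: the primes in (m+1, 2m+1]
    divide the binomial coefficient of 2m+1 at m. *)
Lemma primorial_le (n : nat) : \prod_(0 <= p < n.+1 | prime p) p <= 4 ^ n.
Proof.
elim/ltn_ind: n => n IH.
have [|n2] := leqP n 2.
  by case: n IH => [|[|[|//]]] _ _; rewrite unlock.
have [m [mn|mn]] : exists m, n = m.*2 \/ n = m.*2.+1.
- by exists n./2; have := odd_double_half n; case: (odd n) => /= h; lia.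
- rewrite big_mkcond big_nat_recr//= -big_mkcond.
  have -> : prime n = false.
    by apply/negbTE/negP => /even_prime[|]; rewrite mn ?odd_double//; lia.
  rewrite muln1; case: n IH n2 mn => // n IH n2 mn.
  apply: leq_trans (IH n (ltnSn _)) _; exact: leq_pexp2l.
rewrite (@big_cat_nat _ _ _ m.+2)//=; last lia.
have -> : 4 ^ n = 4 ^ m.+1 * 4 ^ m by rewrite -expnD mn; congr expn; lia.
apply: leq_mul; first by apply: IH; lia.
apply: leq_trans (bin_odd_le m).
apply: dvdn_leq; first by rewrite bin_gt0; lia.
rewrite -big_filter; apply: prod_primes_dvd.
- by rewrite filter_uniq// iota_uniq.
- by rewrite filter_all.
move=> p; rewrite mem_filter mem_index_iota => /andP[pp /andP[p1 p2]].
have : p %| (m.*2.+1)`! by apply: dvdn_fact; rewrite prime_gt0//=; lia.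
rewrite -(@bin_fact m.*2.+1 m); last lia.
rewrite !Euclid_dvdM// => /orP[//|/orP[]] /(prime_dvd_fact pp) ; lia.
Qed.

Lemma central_bin_ge (n : nat) : 0 < n -> 4 ^ n <= n.*2 * 'C(n.*2, n).
Proof.
elim: n => // -[|n] IH _ //.
have {}IH := IH isT.
set m := n.+1 in IH *.
have e1 : m.+1 * 'C(m.+1.*2, m.+1) = m.+1.*2 * 'C(m.*2.+1, m).
  by rewrite doubleS -mul_bin_diag.
have e2 : m.*2.+1 * 'C(m.*2, m) = m.+1 * 'C(m.*2.+1, m).
  by rewrite mul_bin_down; congr (_ * _); lia.
rewrite expnS.
move: IH e1 e2; move: ('C(m.*2, m)) ('C(m.*2.+1, m)) ('C(m.+1.*2, m.+1)) (4 ^ m) =>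
    a b c x h e1 e2.
have e3 : c = 2 * b by nia.
nia.
Qed.

(** Legendre formula for the numerator and the denominator of the central
    binomial coefficient. *)
Lemma logn_central_bin (p n : nat) : prime p ->
  logn p 'C(n.*2, n) = \sum_(1 <= k < n.*2.+1) (n.*2 %/ p ^ k - (n %/ p ^ k).*2).
Proof.
move=> pp.
have hf : logn p n`! = \sum_(1 <= k < n.*2.+1) n %/ p ^ k.
  rewrite logn_fact// [RHS](@big_cat_nat _ _ _ n.+1)//=; last lia.
  rewrite [X in _ = _ + X]big_nat [X in _ = _ + X]big1 ?addn0// => k /andP[nk _].
  by rewrite divn_small// (leq_trans _ (ltnW (ltn_expl k (prime_gt1 pp)))).
have h2 : logn p (n.*2)`! = \sum_(1 <= k < n.*2.+1) n.*2 %/ p ^ k by rewrite logn_fact.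
have hb : logn p (n.*2)`! = logn p 'C(n.*2, n) + (logn p n`!).*2.
  rewrite -(@bin_fact n.*2 n); last lia.
  rewrite (_ : n.*2 - n = n); last lia.
  by rewrite !lognM ?muln_gt0 ?fact_gt0 ?bin_gt0 ?addnn//; lia.
rewrite sumnB => [|k _]; last first.
  have q0 : 0 < p ^ k by rewrite expn_gt0 prime_gt0.
  by rewrite leq_divRL// -doubleMl leq_double leq_divM.
have -> : \sum_(1 <= k < n.*2.+1) (n %/ p ^ k).*2 = (logn p n`!).*2.
  by rewrite hf -[RHS]mul2n big_distrr /=; apply: eq_bigr => k _; rewrite mul2n.
by rewrite -h2 hb addnK.
Qed.

Lemma divn_double_le1 (n q : nat) : n.*2 %/ q - (n %/ q).*2 <= 1.
Proof.
have [->|q0] := posnP q; first by rewrite !divn0.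
rewrite leq_subLR; have := divn_eq n q; have := ltn_pmod n q0.
move: (n %/ q) (n %% q) => a r rq ->.
have -> : (a * q + r).*2 = a.*2 * q + r.*2 by lia.
rewrite divnMDl// leq_add2l -ltnS ltn_divLR//; lia.
Qed.

(** Each term of the Legendre sum is 0 or 1, and those with p^k > 2n vanish. *)
Lemma central_bin_part_le (p n : nat) : prime p -> 0 < n ->
  p ^ logn p 'C(n.*2, n) <= n.*2.
Proof.
move=> pp n0; have p1 := prime_gt1 pp.
apply: (@leq_trans (p ^ trunc_log p n.*2)); last by apply: trunc_logP => //; lia.
rewrite leq_pexp2l ?prime_gt0// logn_central_bin//.
set L := trunc_log p n.*2.
have Ln : L <= n.*2.
  apply: leq_trans (ltnW (ltn_expl L p1)) _.
  by apply: trunc_logP => //; lia.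
rewrite (@big_cat_nat _ _ _ L.+1)//= [X in _ + X]big_nat [X in _ + X]big1 ?addn0;
    last first.
  move=> k /andP[Lk _].
  have h : n.*2 < p ^ k.
    by rewrite ltnNge; apply/negP => /(trunc_log_max p1); rewrite -/L; lia.
  by rewrite divn_small.
apply: (@leq_trans (\sum_(1 <= k < L.+1) 1)).
  by apply: leq_sum => k _; exact: divn_double_le1.
by rewrite sum_nat_const_nat muln1; lia.
Qed.

Lemma central_bin_part_le1 (p n : nat) : prime p -> 0 < n -> n.*2 < p ^ 2 ->
  logn p 'C(n.*2, n) <= 1.
Proof.
move=> pp n0 h; rewrite -ltnS -(ltn_exp2l _ _ (prime_gt1 pp)).
exact: leq_ltn_trans (central_bin_part_le pp n0) h.
Qed.

(** For 2n/3 < p <= n the prime p > 2 occurs twice in (2n)! and once in n!,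
    so it cancels. *)
Lemma central_bin_part0 (p n : nat) : prime p -> 2 < p -> p <= n -> n.*2 < 3 * p ->
  logn p 'C(n.*2, n) = 0.
Proof.
move=> pp p2 pn np; rewrite logn_central_bin// big_nat big1// => k /andP[k1 _].
have [->|k2] := eqVneq k 1.
  rewrite expn1.
  have h1 : n.*2 %/ p < 3 by rewrite ltn_divLR ?prime_gt0.
  have h2 : 0 < n %/ p by rewrite divn_gt0 ?prime_gt0.
  lia.
rewrite divn_small//; apply: leq_trans np _.
apply: (@leq_trans (p ^ 2)); first by rewrite expnS expn1 leq_mul2r; lia.
by rewrite leq_pexp2l; lia.
Qed.

Lemma prod_logn_central (n : nat) :
  'C(n.*2, n) = \prod_(0 <= p < n.*2.+1) p ^ logn p 'C(n.*2, n).
Proof.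
set x := 'C(n.*2, n).
have x0 : 0 < x by rewrite bin_gt0; lia.
rewrite -{1}(partnT x0) (@widen_partn (maxn x n.*2))/=; last exact: leq_maxl.
rewrite (@big_cat_nat _ _ _ n.*2.+1)//=; last by rewrite ltnS leq_maxr.
rewrite [X in _ * X]big_nat_cond [X in _ * X]big1 ?muln1; last first.
  move=> p /andP[/andP[np _] _].
  have [pp|] := boolP (prime p); last by rewrite lognE => /negbTE ->.
  rewrite lognE; case: ifP => // /and3P[_ _ px].
  have : p %| (n.*2)`!.
    by rewrite -(@bin_fact n.*2 n); [exact: dvdn_mulr|lia].
  by move/(prime_dvd_fact pp); lia.
by apply: eq_bigl => p.
Qed.

Lemma prod_nat_init (c s m : nat) :
  \prod_(0 <= p < m) (if p < s then c else 1) = c ^ minn m s.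
Proof.
elim: m => [|m IH]; first by rewrite big_geq// min0n.
rewrite big_nat_recr//= IH; case: ltnP => h.
  by rewrite (minn_idPl h) expnSr.
by rewrite muln1 (minn_idPr (leqW h)).
Qed.

(** Primes up to sqrt(2n) contribute at most 2n each, those up to 2n/3 at
    most once and thus at most the primorial, those in (2n/3, n] nothing, and
    those in (n, 2n] at most 2n each. *)
Lemma central_bin_upper (n s : nat) : 2 < n -> n.*2 < s.+1 ^ 2 ->
  'C(n.*2, n) <= n.*2 ^ s.+1 * 4 ^ (n.*2 %/ 3) *
     n.*2 ^ (\sum_(n.+1 <= p < n.*2.+1 | prime p) 1).
Proof.
move=> n2 hs; rewrite prod_logn_central.
pose A p := if p < s.+1 then n.*2 else 1.
pose B p := if (p < (n.*2 %/ 3).+1) && prime p then p else 1.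
pose C p := if (n < p) && prime p then n.*2 else 1.
apply: (@leq_trans (\prod_(0 <= p < n.*2.+1) (A p * B p * C p))).
  rewrite big_nat [leqRHS]big_nat; apply: leq_prod => p /andP[_ pn].
  have A0 : 0 < A p by rewrite /A; case: ifP; lia.
  have B0 : 0 < B p by rewrite /B; case: ifP => // /andP[_ /prime_gt0].
  have C0 : 0 < C p by rewrite /C; case: ifP; lia.
  have [pp|np] := boolP (prime p); last first.
    by rewrite lognE (negbTE np) expn0 !muln_gt0 A0 B0.
  have [ps|sp] := ltnP p s.+1.
    apply: leq_trans (central_bin_part_le pp _) _; first lia.
    by rewrite {1}/A ps -mulnA leq_pmulr// muln_gt0 B0.
  have h1 : logn p 'C(n.*2, n) <= 1.
    apply: central_bin_part_le1 => //; first lia.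
    by apply: leq_trans hs _; rewrite leq_exp2r.
  have [np|pn'] := ltnP n p.
    apply: (@leq_trans (C p)); last by rewrite leq_pmull// muln_gt0 A0.
    rewrite /C np pp /=; apply: leq_trans (pn : p <= n.*2).
    by apply: leq_trans (leq_pexp2l (prime_gt0 pp) h1) _; rewrite expn1.
  have [p3|p3] := ltnP p (n.*2 %/ 3).+1.
    apply: (@leq_trans (B p)); last by rewrite mulnAC leq_pmull// muln_gt0 A0.
    rewrite /B p3 pp /=.
    by apply: leq_trans (leq_pexp2l (prime_gt0 pp) h1) _; rewrite expn1.
  rewrite central_bin_part0 ?expn0 ?muln_gt0 ?A0 ?B0//.
    lia.
  lia.
rewrite !big_split /= leq_mul//; first apply: leq_mul.
- rewrite prod_nat_init leq_pexp2l ?geq_minr//; lia.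
- rewrite /B -big_mkcond /=; under eq_bigl do rewrite andbC.
  by rewrite -big_nat_widen ?primorial_le// ltnS leq_div.
- rewrite /C -big_mkcond /=; under eq_bigl do rewrite andbC.
  rewrite expn_sum.
  rewrite [leqRHS](big_nat_widenl _ 0)//=.
Qed.

Lemma expn4_le_window_primes (n s : nat) : 2 < n -> n.*2 < s.+1 ^ 2 ->
  4 ^ n <= n.*2 ^ (s.+2 + \sum_(n.+1 <= p < n.*2.+1 | prime p) 1) * 4 ^ (n.*2 %/ 3).
Proof.
move=> n2 hs; apply: leq_trans (central_bin_ge _) _; first lia.
apply: leq_trans (leq_mul (leqnn _) (central_bin_upper n2 hs)) _.
apply: eq_leq; rewrite expnD [n.*2 ^ s.+2]expnS -!mulnA.
by congr (_ * (_ * _)); exact: mulnC.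
Qed.

End chebyshev.

(** * Cardinality of the window of primes *)

Section chebyshev_real.
Context {R : realType}.

Lemma card_window_primes M :
  #|window_primes M| = (\sum_(0 <= p < M.+1 | prime p && (uphalf M < p)%N) 1)%N.
Proof. by rewrite big_mkord -sum1_card; apply: eq_bigl => p; rewrite inE. Qed.

(** For odd M = 2n+1 the window starts at n+2, so it may miss the prime n+1. *)
Lemma half_window_le M :
  ((\sum_((M./2).+1 <= p < (M./2).*2.+1 | prime p) 1) <= #|window_primes M|.+1)%N.
Proof.
have [M2|M2] := leqP M 1.
  by rewrite big_geq// ltnS; case: M M2 => [|[|]].
rewrite card_window_primes big_ltn_cond;
    last by rewrite ltnS -[X in (X < _)%N]muln1 -muln2 ltn_pmul2l ?half_gt0.
apply: (@leq_trans (1 + \sum_((M./2).+2 <= p < (M./2).*2.+1 | prime p) 1));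
    first by case: ifP => // _; exact: leqW.
rewrite add1n ltnS.
have MM := odd_double_half M.
rewrite [leqRHS](@big_cat_nat _ _ _ (M./2).*2.+1)//=;
    last by rewrite ltnS -[leqRHS]MM leq_addl.
apply: leq_trans (leq_addr _ _).
rewrite (big_nat_widenl _ 0)//= big_mkcond [leqRHS]big_mkcond /=.
apply: leq_sum => p _; case: ifP => // /andP[-> hp] /=.
by rewrite ifT// uphalf_half; case: (odd M); lia.
Qed.

Lemma ln2_ge : 2^-1 <= ln 2 :> R.
Proof.
have := @le_ln1Dx R (- 2^-1).
rewrite (_ : 1 - 2^-1 = 2^-1 :> R); last by field.
by rewrite lnV ?posrE// => h; rewrite -lerN2; apply: h; lra.
Qed.

Lemma ln4_ge1 : 1 <= ln 4 :> R.
Proof.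
rewrite (_ : 4 = 2 ^+ 2); last by rewrite -natrX.
by rewrite lnXn// mulr2n; have := ln2_ge; lra.
Qed.

Lemma ln_window_primes (n e q : nat) : (0 < n)%N ->
  (4 ^ n <= n.*2 ^ e * 4 ^ q)%N ->
  n%:R * ln 4 <= e%:R * ln (n.*2%:R) + q%:R * ln 4 :> R.
Proof.
move=> n0 h; have n20 : (0 < n.*2)%N by rewrite double_gt0.
have n2R : 0 < n.*2%:R :> R by rewrite ltr0n.
rewrite !mulr_natl -!lnXn// -lnM ?posrE ?exprn_gt0//.
by rewrite -!natrX -natrM ler_ln ?posrE ?ltr0n ?muln_gt0 ?expn_gt0 ?n20// ler_nat.
Qed.

(** Taking logarithms in the factorization bound, with n = floor(M/2) and s =
    floor(sqrt M): the powers of 4 leave n log 4 / 3 on the left. *)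
Lemma window_primes_card_sqrt (M : nat) : (6 <= M)%N ->
  M%:R / 12 <= (Num.sqrt M%:R + 3 + #|window_primes M|%:R) * ln M%:R :> R.
Proof.
move=> M6; pose n := M./2; pose s := Num.truncn (Num.sqrt M%:R : R).
have MM := odd_double_half M; rewrite -/n in MM.
have [nM n2 nM4] : [/\ (n.*2 <= M)%N, (2 < n)%N & (M <= 4 * n)%N].
  by clearbody n; split; move: MM; case: (odd M) => /=; lia.
have /andP[sy ys] := truncn_itv (sqrtr_ge0 (M%:R : R)).
rewrite -/s in sy ys.
have hs : (n.*2 < s.+1 ^ 2)%N.
  apply: leq_ltn_trans nM _; rewrite -(ltr_nat R) natrX -[ltLHS]sqr_sqrtr//.
  by rewrite ltr_pXn2r ?nnegrE// ?sqrtr_ge0.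
have pP := half_window_le M; rewrite -/n in pP.
have := expn4_le_window_primes n2 hs.
move: pP; set p := (\sum_(_ <= _ < _ | _) 1)%N => pP.
have n0 : (0 < n)%N by apply: leq_trans n2.
move/(ln_window_primes n0) => hl.
set P := #|window_primes M| in pP *.
clearbody p n s P.
have n3 : (n.*2 %/ 3)%:R * 3 <= n%:R * 2 :> R.
  rewrite -!natrM ler_nat; apply: leq_trans (leq_divM _ _) _; by rewrite muln2.
have sp : (s.+2 + p)%:R <= s%:R + 3 + P%:R :> R.
  by rewrite -[3]/(3%:R) -!natrD ler_nat; lia.
have nR4 : M%:R <= 4 * n%:R :> R by rewrite -[4]/(4%:R) -natrM ler_nat.
have lnn : 0 <= ln (n.*2%:R : R) <= ln (M%:R : R).
  by rewrite ln_ge0 ?ler1n ?double_gt0//= ler_ln ?posrE ?ltr0n ?ler_nat ?double_gt0//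
      (leq_trans _ M6).
have h3 : (s.+2 + p)%:R * ln (n.*2%:R) <= (Num.sqrt M%:R + 3 + P%:R) * ln M%:R :> R.
  case/andP: lnn => l0 l1; apply: ler_pM => //.
  by apply: le_trans sp _; rewrite !lerD2r.
have l4 := ln4_ge1; have a0 : 0 <= n%:R :> R by [].
have : 0 <= (n%:R - (n.*2 %/ 3)%:R) * (ln 4 - 1) :> R by apply: mulr_ge0; lra.
by lra.
Qed.

(** For large M the term (sqrt M + 3) log M is at most half of M/12. For the
    remaining M one prime suffices, at the price of a smaller constant. *)
Lemma window_primes_card_ge : exists2 c : R, 0 < c &
  forall M, (2 <= M)%N -> (0 < #|window_primes M|)%N ->
  c * M%:R <= #|window_primes M|%:R * ln M%:R.
Proof.
(* With x = M^(1/4), the threshold x >= 384 = 16 * 24 ensures 16 x^3 <= x^4 /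
   24. K is kept abstract so that its powers are never computed. *)
have [K K6 K384] : exists2 K : R, 6 <= K & 384 <= K by exists 384; rewrite ?ler_nat.
exists (2 * K ^+ 4)^-1; first by rewrite invr_gt0 mulr_gt0// exprn_gt0//; lra.
move=> M M2 P0; set P : R := #|window_primes M|%:R.
have P1 : 1 <= P by rewrite /P ler1n.
have MR : 2 <= M%:R :> R by rewrite (ler_nat _ 2).
have M0 : 0 < M%:R :> R by lra.
pose y : R := Num.sqrt M%:R; pose x : R := Num.sqrt y.
have y2 : y ^+ 2 = M%:R by rewrite sqr_sqrtr// ltW.
have x2 : x ^+ 2 = y by rewrite sqr_sqrtr// sqrtr_ge0.
have x4 : x ^+ 4 = M%:R by rewrite -y2 -x2 -exprM.
have x0 : 0 < x by rewrite !sqrtr_gt0.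
have lnM : ln M%:R = 4 * ln x by rewrite -x4 lnXn// mulr_natl.
have lnM2 : 2^-1 <= ln M%:R :> R.
  by apply: le_trans ln2_ge _; rewrite ler_ln ?posrE.
have x1 : 1 <= x.
  by rewrite -(@ler_pXn2r _ 4)// ?nnegrE ?ltW// x4 expr1n; lra.
have lnx : ln x <= x.
  have := @le_ln1Dx R (x - 1); rewrite addrCA subrr addr0 => h.
  by apply: le_trans (h _) _; lra.
have K0 : 0 < K by lra.
have K1 : 1 <= K by lra.
have [xK|xK] := leP x K.
  apply: (@le_trans _ _ 2^-1); last first.
    by rewrite -[leLHS]mul1r ler_pM.
  rewrite invfM -mulrA ler_piMr// ler_pdivrMl ?exprn_gt0// mulr1 -x4.
  by rewrite ler_pXn2r// nnegrE ltW.
have M6 : (6 <= M)%N.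
  rewrite -(ler_nat R) -x4; apply: le_trans (ler_eXnr _ x1) => //.
  exact: le_trans K6 (ltW xK).
have h4 := window_primes_card_sqrt M6.
rewrite -/P -/y in h4.
apply: (@le_trans _ _ (M%:R / 24)).
  rewrite mulrC ler_pM2l// lef_pV2 ?posrE ?mulr_gt0 ?exprn_gt0//.
  have : K <= K ^+ 4 by apply: ler_eXnr.
  by lra.
have h5 : (y + 3) * ln M%:R <= M%:R / 24.
  rewrite lnM -x4 -x2.
  have e4 : x ^+ 4 = x ^+ 3 * x by rewrite exprSr.
  have e2 : 1 <= x ^+ 2 by rewrite expr_ge1// ltW.
  have e3 : x ^+ 3 = x ^+ 2 * x by rewrite exprSr.
  apply: (@le_trans _ _ (16 * x ^+ 3)).
    rewrite e3 [leRHS](_ : _ = (4 * x ^+ 2) * (4 * x)); last by ring.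
    apply: ler_pM; rewrite ?mulr_ge0 ?ln_ge0 ?addr_ge0 ?sqr_ge0//; first by lra.
    by rewrite ler_pM2l.
  rewrite e4 mulrAC -mulrA [16 * _]mulrC ler_pM2l ?exprn_gt0//.
  by lra.
by lra.
Qed.

End chebyshev_real.

(** * Sums of powers of the weights *)

Section sums_of_decay.
Context {R : realType}.

(** Dyadic blocks are dominated by a geometric series of ratio q = 2^(1-s). *)
Lemma pseries_bounded (s : R) : 1 < s ->
  exists Z : R, forall n, \sum_(1 <= m < n.+1) (m%:R `^ s)^-1 <= Z.
Proof.
move=> s1.
pose q : R := 2 * (2 `^ s)^-1.
have p0 : 0 < 2 `^ s :> R by rewrite powR_gt0.
have q0 : 0 < q by rewrite mulr_gt0// invr_gt0.
have q1 : q < 1.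
  rewrite /q ltr_pdivrMr// mul1r -[ltLHS]powRr1//.
  by rewrite /powR pnatr_eq0 ltr_expR ltr_pM2r// (lt_le_trans _ (@ln2_ge R)).
exists (1 - q)^-1 => n.
have dyadic K : \sum_(1 <= m < 2 ^ K) (m%:R `^ s)^-1 <= (1 - q ^+ K) / (1 - q) :> R.
  elim: K => [|K IH]; first by rewrite big_geq// expr0 subrr mul0r.
  have h2 : (2 ^ K <= 2 ^ K.+1)%N by rewrite leq_exp2l.
  rewrite (@big_cat_nat _ _ _ (2 ^ K))//= ?expn_gt0//.
  apply: (@le_trans _ _ ((1 - q ^+ K) / (1 - q) + q ^+ K)); last first.
    by rewrite exprS le_eqVlt; apply/orP; left; apply/eqP; field; rewrite subr_eq0 gt_eqF.
  apply: lerD => //.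
  apply: (@le_trans _ _ (\sum_(2 ^ K <= m < 2 ^ K.+1) ((2 ^ K)%:R `^ s)^-1)).
    apply: ler_sum_nat => m /andP[Km _].
    rewrite lef_pV2 ?posrE ?powR_gt0 ?ltr0n ?expn_gt0//;
        last by rewrite (leq_trans _ Km)// expn_gt0.
    by apply: ge0_ler_powR; rewrite ?nnegrE ?ler_nat// ltW// (lt_trans _ s1).
  rewrite sumr_const_nat expnS mul2n -addnn addnK -[leLHS]mulr_natl natrX.
  have -> : (2 ^+ K) `^ s = (2 `^ s) ^+ K :> R.
    by rewrite -(@powR_mulrn _ 2)// powRAC powR_mulrn// powR_ge0.
  by rewrite /q exprMn exprVn.
apply: (@le_trans _ _ ((1 - q ^+ n.+1) / (1 - q))); last first.
  rewrite ler_piMl//; first by rewrite invr_ge0 subr_ge0 ltW.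
  by rewrite gerBl exprn_ge0// ltW.
apply: le_trans (dyadic n.+1).
rewrite [leRHS](@big_cat_nat _ _ _ n.+1)//=; last exact/ltnW/ltn_expl.
by rewrite lerDl sumr_ge0// => m _; rewrite invr_ge0 powR_ge0.
Qed.

Lemma ler_sum_sub (T : eqType) (s t : seq T) (F : T -> R) : uniq s ->
  {subset s <= t} -> (forall x, 0 <= F x) ->
  \sum_(x <- s) F x <= \sum_(x <- t) F x.
Proof.
move=> us st F0; elim: s t us st => [|x s IH] t /=.
  by rewrite big_nil sumr_ge0.
move=> /andP[xs us] st.
have xt : x \in t by apply: st; rewrite mem_head.
rewrite big_cons (perm_big _ (perm_to_rem xt)) big_cons lerD2l IH// => y ys.
have := st y; rewrite inE ys orbT => /(_ isT).
rewrite (perm_mem (perm_to_rem xt)) inE => /orP[/eqP yx|//].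
by rewrite -yx ys in xs.
Qed.

Lemma prod_powR (I : Type) (s : seq I) (F : I -> R) (t : R) :
  (forall i, 0 <= F i) -> (\prod_(i <- s) F i) `^ t = \prod_(i <- s) F i `^ t.
Proof.
move=> F0; elim: s => [|i s IH]; first by rewrite !big_nil powR1.
by rewrite !big_cons powRM// ?IH// prodr_ge0.
Qed.

Lemma sum_nth (T : Type) (x0 : T) (l : seq T) (F : T -> R) :
  \sum_(i < size l) F (nth x0 l i) = \sum_(m <- l) F m.
Proof. by rewrite [RHS](big_nth x0) big_mkord. Qed.

(** A finite set of frequencies lies in a box, on which the sum factorizes
    over the coordinates. *)
Lemma sum_decay_le (alpha : R) (gam : nat -> R) (t Z : R) (d : nat)
    (s : seq (d.-tuple int)) :
  0 < alpha -> 0 < t -> (forall j, 0 <= gam j <= 1) ->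
  (forall n, \sum_(1 <= m < n.+1) (m%:R `^ (alpha * t))^-1 <= Z) -> uniq s ->
  \sum_(k <- s) decay alpha gam k `^ t <= \prod_(j < d) (1 + 2 * gam j `^ t * Z).
Proof.
move=> a0 t0 hgam HZ us.
pose n := (\max_(k <- s) \max_(j < d) `|tnth k j|)%N.
(* L lists the integers of absolute value at most n. *)
pose L : seq int := 0 :: [seq m%:Z | m <- index_iota 1 n.+1] ++ [seq - m%:Z | m <- index_iota 1 n.+1].
have memL k j : k \in s -> tnth k j \in L.
  move=> ks; have hn : (`|tnth k j| <= n)%N.
    apply: leq_trans (leq_bigmax_seq _ ks _) => //=.
    exact: (leq_bigmax j).
  rewrite inE mem_cat; case: eqVneq => //= m0.
  case: (intP (tnth k j)) hn m0 => [//|m|m] hn _.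
    by rewrite map_f// mem_index_iota.
  apply/orP; right; apply/mapP; exists m.+1 => //.
  by rewrite mem_index_iota; move: hn; lia.
pose E (f : {ffun 'I_d -> 'I_(size L)}) : d.-tuple int := [tuple nth 0 L (f j) | j < d].
apply: (@le_trans _ _ (\sum_(f : {ffun 'I_d -> 'I_(size L)}) decay alpha gam (E f) `^ t)).
  rewrite -(big_map E predT (fun k => decay alpha gam k `^ t)).
  apply: ler_sum_sub => // [k ks|k]; last exact: powR_ge0.
  have hi j : (index (tnth k j) L < size L)%N by rewrite index_mem memL.
  apply/mapP; exists [ffun j => Ordinal (hi j)]; first by rewrite mem_index_enum.
  by apply: eq_from_tnth => j; rewrite tnth_mktuple ffunE /= nth_index// memL.
rewrite /decay.
under eq_bigr => f _.
  rewrite prod_powR; last by move=> j; exact: decay_factor_ge0.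
  under eq_bigr do rewrite tnth_mktuple.
  over.
rewrite -(bigA_distr_bigA (fun (j : 'I_d) (i : 'I_(size L)) =>
    decay_factor alpha gam j (nth 0 L i) `^ t)) /=.
apply: ler_prod => j _; apply/andP; split.
  by apply: sumr_ge0 => i _; exact: powR_ge0.
have -> : \sum_(i < size L) decay_factor alpha gam j (nth 0 L i) `^ t =
    \sum_(m <- L) decay_factor alpha gam j m `^ t.
  exact: (sum_nth 0 L (fun m => decay_factor alpha gam j m `^ t)).
rewrite big_cons {1}/decay_factor eqxx powR1 lerD2l big_cat !big_map /=.
have g0 : 0 <= gam j by case/andP: (hgam j).
have EF (m : int) : m != 0 -> decay_factor alpha gam j m `^ t =
    gam j `^ t * (`|m%:~R| `^ (alpha * t))^-1.
  move=> m0; rewrite /decay_factor (negbTE m0) powRM ?invr_ge0 ?powR_ge0//.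
  by rewrite -powRN -powRrM mulNr powRN.
have H (sg : nat -> int) : (forall m, (0 < m)%N ->
    sg m != 0 /\ `|(sg m)%:~R| = m%:R :> R) ->
   \sum_(1 <= m < n.+1) decay_factor alpha gam j (sg m) `^ t <= gam j `^ t * Z.
  move=> hsg; rewrite big_nat.
  under eq_bigr => m /andP[m0 _].
    have [s0 sE] := hsg m m0.
    rewrite EF// sE; over.
  by rewrite -big_nat -mulr_sumr ler_wpM2l ?powR_ge0.
rewrite -mulrA mulr_natl mulr2n lerD//.
  by apply: (H (fun m => m%:Z)) => m m0; rewrite -pmulrn normr_nat; split=> //; lia.
apply: (H (fun m => - m%:Z)) => m m0; rewrite rmorphN /= normrN -pmulrn normr_nat;
    split=> //; lia.
Qed.

End sums_of_decay.

(** * Counting generators and draws *)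

Section counting.
Local Open Scope set_scope.

Lemma card_tuple_family (T : finType) (r : nat) (A : 'I_r -> {set T}) :
  #|[set t : r.-tuple T | [forall i, tnth t i \in A i]]| = (\prod_(i < r) #|A i|)%N.
Proof.
pose E (f : {ffun 'I_r -> T}) := [tuple f i | i < r].
have Einj : injective E.
  move=> f g h; apply/ffunP => i.
  by have := congr1 (fun t => tnth t i) h; rewrite !tnth_mktuple.
have -> : [set t : r.-tuple T | [forall i, tnth t i \in A i]] = E @: [set f in family A].
  apply/setP => t; rewrite inE; apply/forallP/imsetP => [h|[f + ->] i].
    exists [ffun i => tnth t i]; last by apply: eq_from_tnth => i;
        rewrite tnth_mktuple ffunE.
    by rewrite inE; apply/familyP => i; rewrite ffunE.
  by rewrite inE tnth_mktuple => /familyP.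
rewrite card_imset// cardsE card_family foldrE big_map.
by rewrite /index_enum -enumT.
Qed.

Lemma card_draws_all (d N r : nat) (A : {set d.-tuple 'I_N}) :
  #|[set Z : r.-tuple (d.-tuple 'I_N) | [forall i, tnth Z i \in A]]| = (#|A| ^ r)%N.
Proof. by rewrite (card_tuple_family (fun=> A)) prod_nat_const card_ord. Qed.

Lemma card_draws (d N r : nat) : #|draws d N r| = (#|generators d N| ^ r)%N.
Proof. exact: card_draws_all. Qed.

(** One coordinate of a uniform draw is uniform. *)
Lemma card_draws_one (d N r : nat) (i0 : 'I_r) (A : {set d.-tuple 'I_N}) :
  A \subset generators d N ->
  (#|[set Z in draws d N r | tnth Z i0 \in A]| * #|generators d N| =
   #|A| * #|draws d N r|)%N.
Proof.
move=> AG; pose F i := if i == i0 then A else generators d N.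
have -> : [set Z in draws d N r | tnth Z i0 \in A] =
    [set Z : r.-tuple (d.-tuple 'I_N) | [forall i, tnth Z i \in F i]].
  apply/setP => Z; rewrite !inE; apply/andP/forallP => [[/forallP h hA] i|h].
    by rewrite /F; case: eqVneq => [->|_].
  split; last by have := h i0; rewrite /F eqxx.
  apply/forallP => i; have := h i; rewrite /F; case: eqP => // _.
  by move/(fintype.subsetP AG).
rewrite card_tuple_family card_draws (bigD1 i0)//= {1}/F eqxx -mulnA; congr (_ * _)%N.
rewrite (eq_bigr (fun=> #|generators d N|)) => [|i /negbTE]; last by rewrite /F => ->.
rewrite prod_nat_const -[LHS]mulnC -expnS; congr (_ ^ _)%N.
rewrite (eq_card (B := predC1 i0))// cardC1 card_ord prednK//.
exact: leq_ltn_trans (leq0n i0) (ltn_ord i0).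
Qed.

Lemma card_generators_gt0 (d N : nat) : (1 < N)%N -> (0 < #|generators d N|)%N.
Proof.
move=> N1; apply/card_gt0P; exists [tuple (Ordinal N1) | j < d].
by rewrite inE; apply/forallP => j; rewrite tnth_mktuple.
Qed.

Definition set_coord (d : nat) (T : Type) (z : d.-tuple T) (j : 'I_d) (a : T) : d.-tuple T :=
  [tuple if i == j then a else tnth z i | i < d].

(** If N does not divide k_j then, the other coordinates of z being fixed, at
    most one z_j satisfies k.z = 0 mod N. Overwriting z_j by all the values
    of 1, ..., N-1 is therefore injective. *)
Lemma card_dual_generators (d N : nat) (k : d.-tuple int) (j : 'I_d) : prime N ->
  ~~ (N %| tnth k j)%Z ->
  (#|[set z in generators d N | (N %| dotz k z)%Z]| * N.-1 <= #|generators d N|)%N.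
Proof.
move=> pN Nk; set A := [set z in _ | _].
pose U : {set 'I_N} := [set a : 'I_N | (0 < a)%N].
have N0 := prime_gt0 pN.
have cU : #|U| = N.-1.
  have -> : U = [set~ Ordinal N0].
    by apply/setP => a; rewrite !inE -(inj_eq val_inj) /= lt0n.
  by rewrite cardsC1 card_ord.
rewrite -cU -cardsX.
pose E (p : d.-tuple 'I_N * 'I_N) := set_coord p.1 j p.2.
have Einj : {in finset.setX A U &, injective E}.
  move=> [z a] [z' a']; rewrite !finset.in_setX /= => /andP[zA _] /andP[zA' _] h.
  have tE i : (if i == j then a else tnth z i) = (if i == j then a' else tnth z' i).
    by have := congr1 (fun t => tnth t i) h; rewrite /E !tnth_mktuple.
  have aa : a = a' by have := tE j; rewrite eqxx.
  have zz i : i != j -> tnth z i = tnth z' i by move=> /negbTE ij; have := tE i;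
      rewrite ij.
  rewrite -aa; congr pair; apply: eq_from_tnth => i.
  have [->|] := eqVneq i j; last exact: zz.
  move: zA zA'; rewrite !inE => /andP[_ D] /andP[_ D'].
  have : (N %| tnth k j * ((tnth z j : nat)%:Z - (tnth z' j : nat)%:Z))%Z.
    rewrite (_ : _ * _ = dotz k z - dotz k z'); first exact: rpredB.
    rewrite /dotz (bigD1 j)//= [\sum_i tnth k i * _](bigD1 j)//= mulrBr.
    rewrite (eq_bigr (fun i => tnth k i * (tnth z' i : nat)%:Z)) => [|l lj];
        last by rewrite zz.
    by ring.
  rewrite Gauss_dvdzr; last by rewrite coprimezE prime_coprime.
  rewrite dvdzE /= => /dvdnP[q hq].
  apply: val_inj => /=; move: hq; have := ltn_ord (tnth z j); have := ltn_ord (tnth z' j).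
  case: q => [|q]; first by lia.
  by rewrite mulSn; move: (q * N)%N (nat_of_ord (tnth z j)) (nat_of_ord (tnth z' j)) => w x y; clear; lia.
rewrite -(card_in_imset Einj); apply/subset_leq_card/fintype.subsetP =>
    _ /imsetP[[z a] + ->].
rewrite finset.in_setX !inE /= => /andP[/andP[/forallP zG _] a0].
by apply/forallP => i; rewrite tnth_mktuple; case: eqP.
Qed.

End counting.

(** * Most generators have a small dual sum *)

Section markov.
Context {R : realType} {d : nat} (alpha : R) (gam : nat -> R) (t S : R).
Hypothesis alpha0 : 0 < alpha.
Hypothesis hgam : forall j, 0 <= gam j <= 1.
Hypothesis t0 : 0 < t.
Hypothesis at1 : 1 <= alpha * t.
Hypothesis HS : forall s : seq (d.-tuple int), uniq s ->
  \sum_(k <- s) decay alpha gam k `^ t <= S.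

Definition divisible (N : nat) (k : d.-tuple int) : bool := [forall j, (N %| tnth k j)%Z].

Lemma decay_factor_mul (N : nat) j (m : int) : (0 < N)%N -> m != 0 ->
  decay_factor alpha gam j (m * N%:Z) = (N%:R `^ alpha)^-1 * decay_factor alpha gam j m.
Proof.
move=> N0 m0; rewrite /decay_factor mulf_eq0 (negbTE m0) /= eqz_nat eqn0Ngt N0 /=.
rewrite rmorphM /= normrM -pmulrn normr_nat powRM// invfM.
by rewrite mulrA mulrC.
Qed.

(** Each nonzero coordinate contributes a factor N^(-alpha), and there is at
    least one. *)
Lemma decay_mul (N : nat) (l : d.-tuple int) : (0 < N)%N -> l != zerov d ->
  decay alpha gam [tuple tnth l j * N%:Z | j < d] <=
      (N%:R `^ alpha)^-1 * decay alpha gam l.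
Proof.
move=> N0 l0.
have NR : 1 <= N%:R :> R by rewrite ler1n.
have [hN hN1] : 0 <= (N%:R `^ alpha)^-1 :> R /\ (N%:R `^ alpha)^-1 <= 1 :> R.
  split; first by rewrite invr_ge0 powR_ge0.
  rewrite invf_le1 ?powR_gt0 ?ltr0n//=.
  by rewrite -[leLHS](powRr0 N%:R) ler_powR// ltW.
have [j lj] : exists j, tnth l j != 0.
  apply/existsP; move: l0; apply: contraR; rewrite negb_exists => /forallP h.
  by apply/eqP/eq_from_tnth => j; rewrite tnth_mktuple; apply/eqP; have := h j;
      rewrite negbK.
rewrite /decay (bigD1 j)//= [in leRHS](bigD1 j)//= tnth_mktuple decay_factor_mul// -mulrA.
rewrite ler_wpM2l// ler_wpM2l ?decay_factor_ge0//.
apply: ler_prod => i _; rewrite tnth_mktuple decay_factor_ge0//=.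
have [->|li] := eqVneq (tnth l i) 0; first by rewrite mul0r.
by rewrite decay_factor_mul// ler_piMl ?decay_factor_ge0.
Qed.

(** The frequencies divisible by N are the N l, for which rho(N l)^t <=
    N^(-alpha t) rho(l)^t <= rho(l)^t / N. *)
Lemma sum_divisible (N : nat) (s : seq (d.-tuple int)) : (0 < N)%N -> uniq s ->
  \sum_(k <- s | (k != zerov d) && divisible N k) decay alpha gam k `^ t <= S / N%:R.
Proof.
move=> N0 us; rewrite -big_filter; set s' := (X in \sum_(_ <- X) _).
pose quo (k : d.-tuple int) := [tuple (tnth k j %/ N)%Z | j < d].
have quoK k : divisible N k -> [tuple tnth (quo k) j * N%:Z | j < d] = k.
  move=> /forallP h; apply: eq_from_tnth => j; rewrite !tnth_mktuple.
  by rewrite divzK.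
have s'P k : k \in s' -> k != zerov d /\ divisible N k.
  by rewrite mem_filter => /andP[/andP[]].
have uq : uniq (map quo s').
  rewrite map_inj_in_uniq ?filter_uniq// => k l /s'P[_ hk] /s'P[_ hl] E.
  by rewrite -(quoK k)// E quoK.
apply: le_trans (ler_wpM2r _ (HS uq)); last by rewrite invr_ge0.
rewrite big_map mulr_suml big_seq [leRHS]big_seq; apply: ler_sum => k ks.
have [k0 hk] := s'P k ks.
have q0 : quo k != zerov d.
  apply: contra k0 => /eqP q0; rewrite -(quoK k)// q0; apply/eqP/eq_from_tnth => j.
  by rewrite !tnth_mktuple mul0r.
have := decay_mul N0 q0; rewrite quoK// => h.
apply: le_trans (ge0_ler_powR (ltW t0) _ _ h) _; rewrite ?nnegrE ?decay_ge0//.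
  by rewrite mulr_ge0 ?decay_ge0// invr_ge0 powR_ge0.
rewrite powRM ?invr_ge0 ?powR_ge0 ?decay_ge0// mulrC ler_wpM2l ?powR_ge0//.
rewrite -powRN -powRrM mulNr powRN lef_pV2 ?posrE ?powR_gt0 ?ltr0n//.
by rewrite -[leLHS]powRr1// ler_powR// ler1n.
Qed.

(** A partial sum of the series that controls the worst-case error of the
    rule generated by z. *)
Definition dual_sum (N : nat) (s : seq (d.-tuple int)) (z : d.-tuple 'I_N) : R :=
  \sum_(k <- s | (k != zerov d) && (N %| dotz k z)%Z) decay alpha gam k `^ t.

Lemma sum_dual_sum (N : nat) (s : seq (d.-tuple int)) : prime N -> uniq s ->
  \sum_(z in generators d N) dual_sum s z <= #|generators d N|%:R * (2 * S / N.-1%:R).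
Proof.
move=> pN us; have N0 := prime_gt0 pN; have N1 := prime_gt1 pN.
have S0 : 0 <= S by have := @HS [::] isT; rewrite big_nil.
have NR : 0 < N.-1%:R :> R by rewrite ltr0n -subn1 subn_gt0.
set G := generators d N.
rewrite /dual_sum; under eq_bigr do rewrite big_mkcond.
rewrite exchange_big /=.
apply: (@le_trans _ _ (\sum_(k <- s) (#|G|%:R *
   ((if (k != zerov d) && divisible N k then decay alpha gam k `^ t else 0) +
     decay alpha gam k `^ t / N.-1%:R)))).
  apply: ler_sum => k _.
  have x0 : 0 <= decay alpha gam k `^ t by exact: powR_ge0.
  have [k0|k0] := eqVneq k (zerov d).
    by rewrite big1// mulr_ge0// add0r divr_ge0.
  rewrite -big_mkcondr /=.
  have [dk|dk] := boolP (divisible N k).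
    rewrite big_mkcondr /= -sum1_card natr_sum mulr_suml.
    apply: ler_sum => z _; rewrite mul1r.
    apply: (@le_trans _ _ (decay alpha gam k `^ t)); first by case: ifP.
    by rewrite lerDl divr_ge0.
  move: dk; rewrite negb_forall => /existsP[j Nk].
  have := card_dual_generators pN Nk.
  rewrite sumr_const add0r -[leLHS]mulr_natl mulrCA mulrC => h.
  rewrite ler_wpM2l// ler_pdivlMr// -natrM ler_nat.
  by apply: leq_trans h; rewrite leq_mul2r; apply/orP; right; apply: eq_leq;
      apply: eq_card => z; rewrite [RHS]finset.in_set unfold_in.
rewrite -mulr_sumr ler_wpM2l// big_split /= -big_mkcond -mulr_suml.
apply: (@le_trans _ _ (S / N%:R + S / N.-1%:R)).
  apply: lerD; first exact: sum_divisible.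
  by apply: ler_wpM2r; [rewrite invr_ge0 ltW | exact: HS].
rewrite -mulrA mulr_natl mulr2n lerD2r ler_wpM2l//.
by rewrite lef_pV2 ?posrE ?ler_nat ?leq_pred ?(ltr0n R N).
Qed.

(** A bound on the whole series over the dual lattice, expressed by its
    partial sums. *)
Definition good (N : nat) (T : R) (z : d.-tuple 'I_N) : Prop :=
  forall s : seq (d.-tuple int), uniq s -> dual_sum s z <= T.

Lemma dual_sum_mono (N : nat) (s s' : seq (d.-tuple int)) (z : d.-tuple 'I_N) : uniq s ->
  {subset s <= s'} -> dual_sum s z <= dual_sum s' z.
Proof.
move=> us ss; rewrite /dual_sum -big_filter -[leRHS]big_filter.
apply: ler_sum_sub; [exact: filter_uniq| |by move=> x; exact: powR_ge0].
by move=> x; rewrite !mem_filter => /andP[-> /ss ->].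
Qed.

(** Markov's inequality. The bad generators are finitely many, so one finite
    set s of frequencies witnesses the badness of all of them at once, and
    the mean of the partial sum over s is bounded. *)
Lemma card_bad (N : nat) (T p : R) : prime N -> 0 < T -> 2 * S / N.-1%:R <= p * T ->
  #|[set z in generators d N | ~~ `[< good T z >]]%SET|%:R <= p * #|generators d N|%:R.
Proof.
move=> pN T0 hT; set bad := finset _.
have /choice[sel Hsel] : forall z : d.-tuple 'I_N, exists s : seq (d.-tuple int),
    z \in bad -> uniq s /\ T < dual_sum s z.
  move=> z; have [zb|zb] := boolP (z \in bad); last by exists [::].
  move: zb; rewrite inE => /andP[_ /asboolPn].
  move/existsNP => [s /not_implyP[us /negP]]; rewrite -ltNge => h.
  by exists s.
(* The union of the witnesses of all the bad generators. *)
pose s := undup (flatten [seq sel z | z <- enum bad]).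
have us : uniq s by exact: undup_uniq.
have := sum_dual_sum pN us.
rewrite (big_setID bad) /= => h.
have badG : generators d N :&: bad = bad :> {set _}.
  by apply/finset.setIidPr; apply/fintype.subsetP => z; rewrite inE => /andP[].
rewrite badG in h.
have h1 : #|bad|%:R * T <= \sum_(z in bad) dual_sum s z.
  rewrite -sum1_card natr_sum mulr_suml; apply: ler_sum => z zb; rewrite mul1r.
  have [uz hz] := Hsel z zb; apply: le_trans (ltW hz) _.
  apply: dual_sum_mono => // k ks; rewrite mem_undup; apply/flattenP.
  by exists (sel z) => //; apply: map_f; rewrite mem_enum.
have h2 : 0 <= \sum_(z in generators d N :\: bad) dual_sum s z.
  by apply: sumr_ge0 => z _; apply: sumr_ge0 => k _; exact: powR_ge0.
rewrite -(ler_pM2r T0); apply: le_trans h1 _.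
apply: (@le_trans _ _ (#|generators d N|%:R * (2 * S / N.-1%:R))); first by lra.
by rewrite [leRHS]mulrAC [leRHS]mulrC ler_wpM2l.
Qed.

End markov.

(** * Consequences for the worst-case error and for divisible frequencies *)

Section good_vectors.
Context {R : realType} {d : nat} (alpha : R) (gam : nat -> R).
Hypothesis alpha0 : 0 < alpha.
Hypothesis hgam : forall j, 0 <= gam j <= 1.

(** The sum of rho^2 is at most the power 2 lambda >= 1 of the sum of
    rho^(1/lambda). *)
Lemma good_wce (lam T : R) (N : nat) (z : d.-tuple 'I_N) : (0 < N)%N ->
  2^-1 <= lam -> 0 < T -> good alpha gam lam^-1 T z ->
  (wce alpha gam (lattice_points (R := R) z) <= (T `^ lam)%:E)%E.
Proof.
move=> N0 hl T0 gz; have l0 : 0 < lam by lra.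
apply: wce_le => //; first exact: powR_gt0.
move=> s us; have hs := gz s us.
have x0 k : 0 <= decay alpha gam k `^ lam^-1 by exact: powR_ge0.
have dE k : decay alpha gam k ^+ 2 = (decay alpha gam k `^ lam^-1) `^ (2 * lam).
  rewrite -powRrM (_ : lam^-1 * (2 * lam) = 2%:R); last by field; rewrite gt_eqF.
  by rewrite powR_mulrn// decay_ge0.
have -> : (T `^ lam) ^+ 2 = T `^ (2 * lam - 1) * T.
  rewrite [RHS]mulrC mulr_powRB1 ?mulr_gt0//; last exact: ltW.
  by rewrite -powR_mulrn ?powR_ge0// -powRrM mulrC.
rewrite -big_filter; rewrite /dual_sum -big_filter in hs.
set s' := [seq k <- s | _] in hs *.
have xT k : k \in s' -> decay alpha gam k `^ lam^-1 <= T.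
  move=> ks; apply: le_trans hs; rewrite (big_rem k)//= lerDl.
  exact: sumr_ge0.
apply: le_trans (ler_wpM2l (powR_ge0 _ _) hs).
rewrite mulr_sumr big_seq [leRHS]big_seq; apply: ler_sum => k ks.
rewrite dE -mulr_powRB1 ?mulr_gt0// mulrC ler_wpM2r//.
by apply: ge0_ler_powR; [lra | rewrite nnegrE | rewrite nnegrE ltW | exact: xT].
Qed.

Lemma leq_expn2_pred (q : nat) : (0 < q)%N -> (q <= 2 ^ q.-1)%N.
Proof. by case: q => // q _; rewrite /= ltn_expl. Qed.

(** One factor is at least M/2 and the others are at least 2. *)
Lemma window_prod_ge (M : nat) (Q : {set 'I_M.+1}) : (0 < #|Q|)%N ->
  Q \subset window_primes M ->
  (M%:R / 2) * 2 ^+ #|Q|.-1 <= (\prod_(N in Q) (N : nat))%:R :> R.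
Proof.
move=> Q0 QW; have /card_gt0P[N0 NQ] := Q0.
have QP N : N \in Q -> prime N /\ (uphalf M < N)%N.
  by move/(fintype.subsetP QW); rewrite inE => /andP[].
rewrite (bigD1 N0)//= natrM; apply: ler_pM; rewrite ?divr_ge0 ?exprn_ge0//.
  have [_ h] := QP _ NQ; rewrite ler_pdivrMr// -natrM ler_nat.
  have := uphalf_half M; have := odd_double_half M.
  by move: h; case: (odd M); move: (M./2) (uphalf M); clear => a b /=; lia.
rewrite -natrX ler_nat (cardD1 N0) NQ /=.
rewrite -prod_nat_const (eq_bigl (fun N => (N \in Q) && (N != N0))) => [|N];
    last by rewrite !inE andbC.
by apply: leq_prod => N /andP[/QP[/prime_gt1]].
Qed.

(** If q primes of the window divide k_j <> 0 then |k_j| >= (M/2) 2^(q-1);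
    the power 2^(-(q-1)) of the decay compensates the factor q. *)
Lemma card_window_divisible (M : nat) (k : d.-tuple int) : 1 <= 2 * alpha -> (2 <= M)%N ->
  k != zerov d ->
  #|[set N in window_primes M | divisible N k]%SET|%:R * decay alpha gam k ^+ 2 <=
  (M%:R / 2) `^ (- (2 * alpha)).
Proof.
move=> a1 M2 k0; set Q := finset _; set q := #|Q|.
have MR : 1 <= M%:R / 2 :> R by rewrite ler_pdivlMr// mul1r ler_nat.
have M0 : 0 < M%:R / 2 :> R by lra.
have [q0|q0] := posnP q; first by rewrite q0 mul0r powR_ge0.
have [j kj] : exists j, tnth k j != 0.
  apply/existsP; move: k0; apply: contraR; rewrite negb_exists => /forallP h.
  by apply/eqP/eq_from_tnth => j; rewrite tnth_mktuple; apply/eqP; have := h j;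
      rewrite negbK.
pose m := `|tnth k j|%N.
have m0 : (0 < m)%N by rewrite absz_gt0.
have QW : Q \subset window_primes M by apply/fintype.subsetP => N; rewrite inE => /andP[].
have prodm : (\prod_(N in Q) (N : nat) <= m)%N.
  apply: dvdn_leq => //.
  rewrite -big_enum /= -(big_map val predT id) /=; apply: prod_primes_dvd.
  - by rewrite map_inj_uniq ?enum_uniq//; exact: val_inj.
  - apply/allP => _ /mapP[N + ->]; rewrite mem_enum => /(fintype.subsetP QW).
    by rewrite inE => /andP[].
  - move=> _ /mapP[N + ->]; rewrite mem_enum inE => /andP[_ /forallP/(_ j)].
    by rewrite dvdzE.
have hm : (M%:R / 2) * 2 ^+ q.-1 <= m%:R :> R.
  by apply: le_trans (window_prod_ge q0 QW) _; rewrite ler_nat.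
have mR : 0 < m%:R :> R by rewrite ltr0n.
have hd : decay alpha gam k <= m%:R `^ (- alpha).
  apply: le_trans (decay_le_factor alpha0 hgam k j) _.
  apply: le_trans (decay_factor_powR alpha hgam j kj) _.
  by rewrite powRN /m natr_absz intr_norm.
have hd2 : decay alpha gam k ^+ 2 <= m%:R `^ (- (2 * alpha)).
  rewrite (_ : - (2 * alpha) = - alpha * 2%:R); last by rewrite mulNr mulrC.
  rewrite powRrM powR_mulrn ?powR_ge0// ler_pXn2r// nnegrE ?powR_ge0//.
  exact: decay_ge0.
have P2 : 0 < 2 ^+ q.-1 :> R by rewrite exprn_gt0.
have h1 : m%:R `^ (- (2 * alpha)) <= (M%:R / 2) `^ (- (2 * alpha)) * (2 ^+ q.-1)^-1.
  rewrite !powRN -invfM lef_pV2 ?posrE ?mulr_gt0 ?powR_gt0//.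
  apply: (@le_trans _ _ ((M%:R / 2 * 2 ^+ q.-1) `^ (2 * alpha))).
    rewrite (powRM _ (ltW M0) (ltW P2)) ler_wpM2l ?powR_ge0// le1r_powR//.
    by rewrite exprn_ege1// ler1n.
  apply: ge0_ler_powR => //; first by lra.
    by rewrite nnegrE ltW// mulr_gt0.
  by rewrite nnegrE ltW.
apply: le_trans (ler_wpM2l _ (le_trans hd2 h1)) _ => //.
rewrite mulrCA ler_piMr ?powR_ge0// ler_pdivrMr// mul1r -natrX ler_nat.
exact: leq_expn2_pred.
Qed.

End good_vectors.

(** * Error of the randomized algorithm *)

Section algorithm_error.
Context {R : realType} {d : nat} (alpha : R) (gam : nat -> R).
Hypothesis alpha0 : 0 < alpha.
Hypothesis hgam : forall j, 0 <= gam j <= 1.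

Lemma ndivisible_neq_zerov (N : nat) (k : d.-tuple int) : ~~ divisible N k ->
    k != zerov d.
Proof.
apply: contra => /eqP ->; apply/forallP => j.
by rewrite tnth_mktuple dvdz0.
Qed.

(** If some draw is good then the selected vector has worst-case error at
    most B; hence N can divide k.z* only if rho(k) <= B, and N then divides
    k.z for one of the r draws. *)
Lemma draws_hit (N r : nat) (zs : r.-tuple (d.-tuple 'I_N) -> d.-tuple 'I_N)
    (k : d.-tuple int) (t T B p : R) : prime N ->
  (forall Z, Z \in draws d N r -> zs Z \in (Z : seq _) /\ forall z, z \in (Z : seq _) ->
     (wce alpha gam (lattice_points (R :=
         R) (zs Z)) <= wce alpha gam (lattice_points (R := R) z))%E) ->
  ~~ divisible N k -> 0 <= B ->
  (forall z : d.-tuple 'I_N, good alpha gam t T z ->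
      (wce alpha gam (lattice_points (R := R) z) <= B%:E)%E) ->
  #|[set z in generators d N | ~~ `[< good alpha gam t T z >]]%SET|%:R <=
      p * #|generators d N|%:R ->
  (\sum_(Z in draws d N r) (N %| dotz k (zs Z))%Z%:R) * decay alpha gam k ^+ 2 <=
  #|draws d N r|%:R * (p ^+ r + r%:R * (B ^+ 2 / N.-1%:R)).
Proof.
move=> pN Hzs Nk B0 Hgood; set bad := finset _ => Hbad.
have N0 := prime_gt0 pN; have N1 := prime_gt1 pN.
have G0 : 0 < #|generators d N|%:R :> R by rewrite ltr0n card_generators_gt0.
have NR : 0 < N.-1%:R :> R by rewrite ltr0n -subn1 subn_gt0.
have k0 := ndivisible_neq_zerov Nk.
have d0 := decay_ge0 alpha hgam k.
have d1 : decay alpha gam k ^+ 2 <= 1 by rewrite expr_le1// decay_le1.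
have point Z : Z \in draws d N r ->
   (N %| dotz k (zs Z))%Z%:R * decay alpha gam k ^+ 2 <=
   [forall i, tnth Z i \in bad]%:R + \sum_(i < r) (N %| dotz k (tnth Z i))%Z%:R * B ^+ 2.
  move=> ZD; have [zZ zmin] := Hzs Z ZD.
  have S0 : 0 <= \sum_(i < r) (N %| dotz k (tnth Z i))%Z%:R * B ^+ 2.
    by apply: sumr_ge0 => i _; rewrite mulr_ge0 ?sqr_ge0.
  case: (boolP (N %| dotz k (zs Z))%Z) => hit; last first.
    by rewrite mul0r addr_ge0.
  rewrite mul1r; case: (boolP [forall i, tnth Z i \in bad]) => allbad.
    by apply: le_trans d1 _; rewrite lerDl.
  rewrite add0r; case/forallPn: allbad => i; rewrite inE negb_and negbK.
  have ZiG : tnth Z i \in generators d N by move: ZD; rewrite inE => /forallP.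
  rewrite ZiG /= => /asboolP/Hgood hw.
  have dB : decay alpha gam k <= B.
    rewrite -lee_fin; apply: le_trans (decay_le_wce alpha0 hgam N0 k0 hit) _.
    by apply: le_trans (zmin _ (mem_tnth _ _)) hw.
  have [i0 zi0] := tnthP _ _ zZ.
  rewrite (bigD1 i0)//= -zi0 hit mul1r.
  apply: (@le_trans _ _ (B ^+ 2)); first by rewrite ler_pXn2r// nnegrE.
  by rewrite lerDl sumr_ge0// => l _; rewrite mulr_ge0 ?sqr_ge0.
rewrite mulr_suml; apply: le_trans (ler_sum _ point) _.
rewrite big_split mulrDr /= lerD//.
  have -> : \sum_(Z in draws d N r) ([forall i, tnth Z i \in bad]%:R : R) =
      (#|bad| ^ r)%N%:R.
    rewrite -natr_sum -big_mkcondr /= sum1_card -card_draws_all; congr (_%:R);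
        apply: eq_card => Z.
    rewrite [RHS]finset.in_set unfold_in andb_idl// => /forallP h.
    rewrite inE; apply/forallP => i; have := h i; rewrite inE => /andP[]//.
  rewrite card_draws !natrX mulrC -exprMn.
  by apply: lerXn2r; rewrite ?nnegrE// (le_trans _ Hbad).
rewrite exchange_big /= mulrCA -[X in X%:R * _]card_ord [leRHS]mulr_natl -sumr_const.
apply: ler_sum => i _; rewrite -mulr_suml [leLHS]mulrC [leRHS]mulrCA ler_wpM2l ?sqr_ge0//.
rewrite ler_pdivlMr// -(ler_pM2r G0).
move: Nk; rewrite negb_forall => /existsP[j Nj].
pose A := [set z in generators d N | (N %| dotz k z)%Z]%SET.
have AG : A \subset generators d N by apply/fintype.subsetP => z; rewrite inE => /andP[].
have hA := card_dual_generators pN Nj; rewrite -/A in hA.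
have -> : \sum_(Z in draws d N r) ((N %| dotz k (tnth Z i))%Z%:R : R) =
    #|[set Z in draws d N r | tnth Z i \in A]%SET|%:R.
  rewrite -natr_sum -big_mkcondr /= sum1_card; congr (_%:R); apply: eq_card => Z.
  rewrite [RHS]finset.in_set unfold_in; apply: andb_id2l => ZD.
  rewrite finset.in_set; suff -> : tnth Z i \in generators d N by [].
  by move: ZD; rewrite inE => /forallP.
rewrite mulrAC -natrM card_draws_one// -!natrM ler_nat mulnAC mulnC leq_mul2l hA orbT//.
Qed.

End algorithm_error.

Lemma unif_mean_le {R : realType} (I : finType) (A : {set I}) (F : I ->
    \bar R) (G : I -> R) (x : R) :
  (forall a, a \in A -> (F a <= (G a)%:E)%E) -> \sum_(a in A) G a <= #|A|%:R * x ->
      0 <= x ->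
  (unif_mean A F <= x%:E)%E.
Proof.
move=> FG Gx x0; rewrite /unif_mean.
have [A0|A0] := posnP #|A|; first by rewrite A0 invr0 mul0e lee_fin.
have AR : 0 < #|A|%:R :> R by rewrite ltr0n.
apply: (@le_trans _ _ ((#|A|%:R^-1)%:E * (\sum_(a in A) G a)%:E)%E).
  by rewrite lee_wpmul2l ?lee_fin ?invr_ge0// -sumEFin; exact: lee_sum.
by rewrite -EFinM lee_fin ler_pdivrMl.
Qed.

Lemma window_pred_ge (M N : nat) : (uphalf M < N)%N -> (M <= 2 * N.-1)%N.
Proof.
have := uphalf_half M; have := odd_double_half M.
by case: (odd M); move: (M./2) (uphalf M); clear => a b /=; lia.
Qed.

Section mean_squared.
Context {R : realType} {d : nat} (alpha : R) (gam : nat -> R).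
Hypothesis alpha0 : 0 < alpha.
Hypothesis hgam : forall j, 0 <= gam j <= 1.

(** The conditional probability, given N, that N divides k.z* for the
    selected vector z*. *)
Definition hit_rate (N r : nat) (zs : r.-tuple (d.-tuple 'I_N) -> d.-tuple 'I_N)
    (k : d.-tuple int) : R :=
  (\sum_(Z in draws d N r) (N %| dotz k (zs Z))%Z%:R) / #|draws d N r|%:R.

Lemma hit_rate_ge0 (N r : nat) (zs : r.-tuple (d.-tuple 'I_N) -> d.-tuple 'I_N) k :
  0 <= hit_rate zs k.
Proof. by rewrite divr_ge0// sumr_ge0. Qed.

Lemma card_draws_gt0 (N r : nat) : (1 < N)%N -> (0 < #|draws d N r|)%N.
Proof. by move=> N1; rewrite card_draws expn_gt0 card_generators_gt0. Qed.

Lemma hit_rate_le1 (N r : nat) (zs : r.-tuple (d.-tuple 'I_N) -> d.-tuple 'I_N) k :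
  (1 < N)%N -> hit_rate zs k <= 1.
Proof.
move=> N1; rewrite ler_pdivrMr ?ltr0n ?card_draws_gt0// mul1r -sum1_card natr_sum.
by apply: ler_sum => Z _; case: (_ \in _).
Qed.

(** The mean squared error is at most the sum over k of w(k) = energy f k
    times the mean of rho(k)^2 over the event that N divides k.z*, and the
    w(k) have sum at most 1. *)
Lemma mse_le (M r : nat) (zstar : selection d r) (f : d.-tuple R -> R) (X : R) :
  korobov_ball alpha gam f -> 0 <= X ->
  (forall k : d.-tuple int, k != zerov d ->
    \sum_(N in window_primes M) decay alpha gam k ^+ 2 * hit_rate (zstar N) k <=
      #|window_primes M|%:R * X) ->
  (mean_squared_error M zstar f <= X%:E)%E.
Proof.
move=> bf X0 HX; have [kf _] := bf.
apply/lee_addgt0Pr => eps eps0.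
(* This choice gives (1 + e) (X + e) <= X + eps. *)
pose e := Num.min 1 (eps / (2 + X)).
have X2 : 0 < 2 + X by rewrite ltr_pwDl.
have e0 : 0 < e by rewrite lt_min ltr01 divr_gt0.
have e1 : e <= 1 by rewrite ge_min lexx.
have e2 : e * (2 + X) <= eps by rewrite -ler_pdivlMr// ge_min lexx orbT.
have [F HF] := shifted_error_bound kf e0.
apply: (@le_trans _ _ ((1 + e) * (X + e))%:E); last by rewrite -EFinD lee_fin; nra.
pose w k := energy alpha gam f k.
pose Err (N : nat) := (1 + e) * (\sum_(k <- F | k != zerov d)
   w k * (decay alpha gam k ^+ 2 * hit_rate (zstar N) k) + e).
have w0 k : 0 <= w k by exact: energy_ge0.
apply: (@unif_mean_le _ _ _ _ (fun N : 'I_M.+1 => Err N)).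
- move=> N; rewrite inE => /andP[pN _].
  have N0 := prime_gt0 pN; have N1 := prime_gt1 pN.
  have D0 : #|draws d N r|%:R != 0 :> R by rewrite pnatr_eq0 -lt0n card_draws_gt0.
  apply: (@unif_mean_le _ _ _ _ (fun Z =>
      (1 + e) * (\sum_(k <- F | (k != zerov d) && (N %| dotz k (zstar N Z))%Z)
      (coef_cos f k ^+ 2 + coef_sin f k ^+ 2) + e))).
  + by move=> Z _; exact: HF.
  + rewrite -mulr_sumr /Err mulrCA ler_wpM2l//; first by rewrite addr_ge0// ltW.
    rewrite big_split /= mulrDr lerD//; last by rewrite sumr_const mulr_natl.
    rewrite [leLHS](_ : _ = \sum_(Z in draws d N r) \sum_(k <- F | k != zerov d)
       w k * decay alpha gam k ^+ 2 * (N %| dotz k (zstar N Z))%Z%:R); last first.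
      apply: eq_bigr => Z _; rewrite big_mkcondr /=; apply: eq_bigr => k _.
      by rewrite (energyE hgam k kf) [_ * energy _ _ _ _]mulrC; case: ifP;
          rewrite ?mulr1 ?mulr0.
    rewrite exchange_big /= mulr_sumr; apply: ler_sum => k _.
    rewrite -mulr_sumr /hit_rate le_eqVlt; apply/orP; left; apply/eqP; field.
    done.
  + rewrite mulr_ge0 ?addr_ge0 ?(ltW e0)//; apply: sumr_ge0 => k _.
    by apply: mulr_ge0 => //; apply: mulr_ge0; [exact: sqr_ge0|exact: hit_rate_ge0].
- rewrite -mulr_sumr mulrCA ler_wpM2l//; first by rewrite addr_ge0// ltW.
  rewrite big_split /= mulrDr lerD//; last by rewrite sumr_const mulr_natl.
  rewrite exchange_big /=.
  apply: (@le_trans _ _ (\sum_(k <- F | k != zerov d) w k * (#|window_primes M|%:R * X))).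
    by apply: ler_sum => k k0; rewrite -mulr_sumr ler_wpM2l// HX.
  rewrite -mulr_suml ler_piMl ?mulr_ge0//.
  by rewrite -big_filter; apply: energy_sum => //; rewrite filter_uniq// fset_uniq.
- by rewrite mulr_ge0 ?addr_ge0 ?(ltW e0).
Qed.

Lemma window_hit_le (M r : nat) (zstar : selection d r) (t T B p : R) (k : d.-tuple int) :
  1 <= 2 * alpha -> (2 <= M)%N -> best_selection M alpha gam zstar ->
  k != zerov d -> 0 <= B -> 0 <= p ->
  (forall (N : nat) (z : d.-tuple 'I_N), (0 < N)%N -> good alpha gam t T z ->
     (wce alpha gam (lattice_points (R := R) z) <= B%:E)%E) ->
  (forall N : nat, prime N -> (uphalf M < N)%N ->
     #|[set z in generators d N | ~~ `[< good alpha gam t T z >]]%SET|%:R <=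
         p * #|generators d N|%:R) ->
  \sum_(N in window_primes M) decay alpha gam k ^+ 2 * hit_rate (zstar N) k <=
    (M%:R / 2) `^ (- (2 * alpha)) +
    #|window_primes M|%:R * (p ^+ r + r%:R * (B ^+ 2 * (2 / M%:R))).
Proof.
move=> a1 M2 Hbest k0 B0 p0 Hgood Hbad.
have M0 : 0 < M%:R :> R by rewrite ltr0n; lia.
set Y := p ^+ r + _.
have Y0 : 0 <= Y.
  by rewrite addr_ge0 ?exprn_ge0// !mulr_ge0 ?sqr_ge0// invr_ge0 ltW.
rewrite (bigID (fun N : 'I_M.+1 => divisible N k)) /= lerD//.
  apply: le_trans (card_window_divisible alpha0 hgam a1 M2 k0).
  rewrite -sum1_card natr_sum mulr_suml big_mkcond [leRHS]big_mkcond /=.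
  apply: ler_sum => N _; rewrite [in leRHS]finset.in_set [in leRHS]finset.in_set finset.in_set.
  case: ifP => // /andP[/andP[pN _] _].
  by rewrite mul1r ler_piMr ?sqr_ge0// hit_rate_le1// prime_gt1.
apply: (@le_trans _ _ (\sum_(N in window_primes M) Y));
    last by rewrite sumr_const mulr_natl.
rewrite [leRHS](bigID (fun N : 'I_M.+1 => divisible N k)) /= -[leLHS]add0r lerD//.
  exact: sumr_ge0.
apply: ler_sum => N /andP[NW Nk]; have := NW; rewrite inE => /andP[pN hN].
have D0 : 0 < #|draws d N r|%:R :> R by rewrite ltr0n card_draws_gt0// prime_gt1.
have := draws_hit alpha0 hgam (r :=
    r) pN (Hbest N NW) Nk B0 (fun z => Hgood N z (prime_gt0 pN)) (Hbad N pN hN).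
rewrite mulrC -ler_pdivrMl// => h.
rewrite /hit_rate mulrA mulrC; apply: le_trans h _.
rewrite /Y lerD2l ler_wpM2l// ler_wpM2l ?sqr_ge0//.
rewrite ler_pdivlMr// mulrC ler_pdivrMr ?ltr0n; last by rewrite -subn1 subn_gt0 prime_gt1.
by rewrite -natrM ler_nat window_pred_ge.
Qed.

End mean_squared.

(** * Rates *)

Section rates.
Context {R : realType}.

Lemma rate_cvg (alpha : R) :
  ((fun p : R * R => rate p.1 p.2) @ filter_prod alpha^'- 0^'+ --> - alpha - 2^-1).
Proof.
have c1 : (fun p : R * R => p.1) @ filter_prod alpha^'- 0^'+ --> alpha.
  apply: cvg_trans cvg_fst _; exact: cvg_within.
have c2 : (fun p : R * R => p.2) @ filter_prod alpha^'- 0^'+ --> (0 : R).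
  apply: cvg_trans cvg_snd _; exact: cvg_within.
rewrite /rate (_ : - alpha - 2^-1 = - alpha - 2^-1 + alpha * 0 / 2);
    last by rewrite mulr0 mul0r addr0.
apply: cvgD; first by apply: cvgD; [exact: cvgN|exact: cvg_cst].
by apply: cvgM; [exact: cvgM|exact: cvg_cst].
Qed.

Lemma num_draws_bounds (alpha eta : R) (M : nat) : 0 < alpha -> 0 < eta < 1 ->
    (2 <= M)%N ->
  let A := (2 * alpha + 1) / - ln (1 - eta) in
  0 < A /\ A * ln M%:R <= (num_draws alpha eta M)%:R <= A * ln M%:R + 1.
Proof.
move=> a0 /andP[e0 e1] M2 A.
have l0 : ln (1 - eta) < 0 by rewrite ln_lt0// subr_gt0 e1 gtrBl.
have A0 : 0 < A by rewrite divr_gt0 ?oppr_gt0// addr_gt0// mulr_gt0.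
have lM : 0 < ln M%:R :> R by rewrite ln_gt0// ltr1n.
split => //; rewrite /num_draws.
have -> : - ((2 * alpha + 1) * (ln M%:R / ln (1 - eta))) = A * ln M%:R.
  by rewrite /A; field; rewrite lt_eqF.
set y := A * _; have y0 : 0 < y by rewrite mulr_gt0.
have c0 : 0 <= Num.ceil y by rewrite ceil_ge0 (lt_trans _ y0).
rewrite natr_absz ger0_norm//.
by rewrite ceil_ge /= -lerBlDr -[1]/(1%:~R) -rmorphB /= ltW// ceilB1_lt.
Qed.

(** A bound on the probability that all draws are bad; the number of draws is
    chosen for it. *)
Lemma bad_power (alpha eta : R) (M : nat) : 0 < alpha -> 0 < eta < 1 -> (2 <= M)%N ->
  (1 - eta) ^+ num_draws alpha eta M <= M%:R `^ (- (2 * alpha + 1)).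
Proof.
move=> a0 e01 M2; have [A0 /andP[h _]] := num_draws_bounds a0 e01 M2.
move: e01 => /andP[e0 e1].
have l0 : ln (1 - eta) < 0 by rewrite ln_lt0// subr_gt0 e1 gtrBl.
have p0 : 0 < 1 - eta by rewrite subr_gt0.
rewrite -[X in X ^+ _](lnK p0) -expRM_natl /powR gt_eqF ?ltr0n ?(leq_trans _ M2)//
    ler_expR.
rewrite (_ : - (2 * alpha + 1) * _ =
    (2 * alpha + 1) / - ln (1 - eta) * ln M%:R * ln (1 - eta)); last first.
  by field; rewrite lt_eqF.
by rewrite ler_wnM2r// ltW.
Qed.

End rates.

(** * The bound on the root mean squared error *)

Section final.
Context {R : realType}.

Lemma mean_squared_error_ge0 (d r M : nat) (zstar : selection d r) (f : d.-tuple R -> R) :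
  (0 <= mean_squared_error M zstar f)%E.
Proof.
apply: mule_ge0; first by rewrite lee_fin invr_ge0.
apply: sume_ge0 => N _; apply: mule_ge0; first by rewrite lee_fin invr_ge0.
by apply: sume_ge0 => Z _; apply: integral_ge0 => D _; rewrite lee_fin sqr_ge0.
Qed.

Lemma rms_error_le (d r M : nat) (alpha : R) (gam : nat ->
    R) (zstar : selection d r) (x : R) :
  0 <= x ->
  (forall f, korobov_ball alpha gam f ->
      (mean_squared_error M zstar f <= (x ^+ 2)%:E)%E) ->
  (rms_error M alpha gam zstar <= x%:E)%E.
Proof.
move=> x0 H; apply: ge_ereal_sup => _ [f bf <-].
have -> : x%:E = ((x ^+ 2)%:E `^ 2^-1)%E.
  by rewrite poweR_EFin powR12_sqrt ?sqr_ge0// sqrtr_sqr ger0_norm.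
apply: gt0_ler_poweR => //; last exact: H.
  by rewrite in_itv /= mean_squared_error_ge0 leey.
by rewrite in_itv /= lee_fin sqr_ge0 leey.
Qed.

Lemma draws_term_le (r A D L E : R) : 0 < A -> 0 < D -> 0 < E -> 2^-1 <= L ->
  r <= A * L + 1 -> r * (2 * (D * E)) <= 4 * (A + 2) * D * L ^+ 2 * E.
Proof.
move=> A0 D0 E0 L2 hr; have h1 : r <= (A + 2) * L by lra.
have DE : 0 < D * E by rewrite mulr_gt0.
apply: (@le_trans _ _ ((A + 2) * L * (2 * (D * E)))).
  by rewrite ler_wpM2r// mulr_ge0// ltW.
rewrite -subr_ge0.
have -> : 4 * (A + 2) * D * L ^+ 2 * E - (A + 2) * L * (2 * (D * E)) =
  2 * ((A + 2) * L * (D * E) * (2 * L - 1)) by ring.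
have A2 : 0 <= A + 2 by lra.
have L0 : 0 <= L by lra.
have L1 : 0 <= 2 * L - 1 by lra.
by apply: mulr_ge0 => //; do 3 ?apply: mulr_ge0 => //; rewrite ltW.
Qed.

Lemma window_term_le (P V E W L c m : R) : 0 < V -> 0 < E -> 0 < W -> 2^-1 <= L ->
  P <= c * V * E * m -> c * m <= W * L -> P <= 2 * V * L ^+ 2 * E * W.
Proof.
move=> V0 E0 W0 L2 hP hc.
have VE : 0 < V * E by rewrite mulr_gt0.
have h1 : V * E * (c * m) <= V * E * (W * L) by rewrite ler_wpM2l// ltW.
have L1 : 0 <= 2 * L - 1 by lra.
have L0 : 0 <= L by lra.
have h2 : 0 <= V * E * (W * (L * (2 * L - 1))).
  by rewrite mulr_ge0 ?(ltW VE)// mulr_ge0 ?(ltW W0)// mulr_ge0.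
have e1 : c * V * E * m = V * E * (c * m) by ring.
have e2 : 2 * V * L ^+ 2 * E * W =
    V * E * (W * (L * (2 * L - 1))) + V * E * (W * L) by ring.
by rewrite e2; rewrite e1 in hP; lra.
Qed.

(** The constant depends on the dimension and on the weights through S only. *)
Lemma rms_bound_of_sum (alpha eta lambda delta S : R) (gam : nat -> R) :
  2^-1 < alpha -> (forall j, 0 <= gam j <= 1) -> 0 < eta < 1 ->
  2^-1 <= lambda < alpha -> 0 < delta -> 0 < S ->
  exists2 C : R, 0 < C & forall d : nat,
    (forall s : seq (d.-tuple int), uniq s ->
       \sum_(k <- s) decay alpha gam k `^ lambda^-1 <= S) ->
    rms_bound d alpha eta gam lambda delta C.
Proof.
move=> ha hgam heta /andP[hl la] dl0 S0.
have a0 : 0 < alpha by lra.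
have l0 : 0 < lambda by lra.
have [e0 e1] := andP heta.
have exp1 : - (2 * alpha + 1) <= - (2 * lambda + 1) by lra.
have exp2 : - (2 * alpha) <= - (2 * lambda + 1) + 1 by lra.
have exp3 : - (2 * lambda + 1) <= rate lambda delta * 2%:R.
  by rewrite /rate; have : 0 < lambda * delta by [rewrite mulr_gt0]; lra.
have a1 : 1 <= 2 * alpha by lra.
pose p : R := 1 - eta; have p0 : 0 < p by rewrite subr_gt0.
pose A := (2 * alpha + 1) / - ln (1 - eta).
have A0 : 0 < A by have [] := num_draws_bounds a0 heta (leqnn 2).
have [c c0 Hc] := @window_primes_card_ge R.
pose D := (4 * S / p) `^ (2 * lambda).
have D0 : 0 < D by rewrite powR_gt0// divr_gt0// mulr_gt0.
pose V := 2 `^ (2 * alpha) / c.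
have V0 : 0 < V by rewrite divr_gt0// powR_gt0.
(* The three terms of K come from the event that all draws are bad, from the
   union bound over the draws, and from the primes that divide k. *)
pose K : R := 4 + 4 * (A + 2) * D + 2 * V.
have K0 : 0 < K.
  have : 0 < (A + 2) * D by rewrite mulr_gt0// addr_gt0.
  by rewrite /K; lra.
exists (Num.sqrt K); first by rewrite sqrtr_gt0.
move=> d HS M [M2 _] zstar Hbest.
set r := num_draws alpha eta M in zstar Hbest *.
have MR : 2 <= M%:R :> R by rewrite (ler_nat _ 2).
have M0 : 0 < M%:R :> R by lra.
have M1 : 1 <= M%:R :> R by lra.
set L := ln M%:R.
have L2 : 2^-1 <= L :> R.
  by apply: le_trans (@ln2_ge R) _; rewrite ler_ln ?posrE.
have L0 : 0 < L by lra.
have LL : 1 <= 4 * L ^+ 2 by nra.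
have [_ /andP[_ hr]] := num_draws_bounds a0 heta M2; rewrite -/A -/r -/L in hr.
(* T bounds the dual sums of good generators, uniformly in N since N - 1 >=
   M/2; then B^2 / M = D E, where B = T^lambda. *)
pose T : R := 4 * S / p / M%:R.
have T0 : 0 < T by rewrite !divr_gt0// mulr_gt0.
pose E := M%:R `^ (- (2 * lambda + 1)) : R.
have E0 : 0 < E by rewrite powR_gt0.
have hE : E <= M%:R `^ rate lambda delta ^+ 2.
  by rewrite -powR_mulrn ?powR_ge0// -powRrM; exact: ler_powR.
have MD x y : M%:R `^ (x + y) = M%:R `^ x * M%:R `^ y :> R.
  by rewrite powRD//; apply/implyP => _; rewrite gt_eqF.
have hB : (T `^ lambda) ^+ 2 / M%:R = D * E.
  rewrite -powR_mulrn ?powR_ge0// -powRrM mulrC [lambda * _]mulrC.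
  rewrite /T powRM ?invr_ge0 ?ltW ?divr_gt0 ?mulr_gt0//.
  rewrite -/D mulrCA; congr (_ * _).
  rewrite /E opprD MD [LHS]mulrC powR_inv1 ?(ltW M0)//; congr (_ * _).
  by rewrite -powR_inv1 ?(ltW M0)// -powRrM mulN1r.
pose W := #|window_primes M|%:R : R.
pose Y : R := p ^+ r + r%:R * ((T `^ lambda) ^+ 2 * (2 / M%:R)).
have hpr : p ^+ r <= 4 * L ^+ 2 * E.
  apply: le_trans (bad_power a0 heta M2) _.
  apply: (@le_trans _ _ E); last by rewrite ler_peMl// ltW.
  exact: ler_powR.
have hrr : r%:R * ((T `^ lambda) ^+ 2 * (2 / M%:R)) <= 4 * (A + 2) * D * L ^+ 2 * E.
  rewrite [(_ ^+ 2) * _]mulrCA hB.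
  exact: draws_term_le.
have Y0 : 0 <= Y.
  apply: addr_ge0; first by apply: exprn_ge0; exact: ltW.
  by apply: mulr_ge0 => //; apply: mulr_ge0; [exact: sqr_ge0|rewrite divr_ge0].
have P00 : 0 <= (M%:R / 2) `^ (- (2 * alpha)) :> R by exact: powR_ge0.
have hW : (M%:R / 2) `^ (- (2 * alpha)) / W <= 2 * V * L ^+ 2 * E.
  have RHS0 : 0 <= 2 * V * L ^+ 2 * E.
    have VE0 : 0 <= V * E by rewrite mulr_ge0// ltW.
    have -> : 2 * V * L ^+ 2 * E = 2 * (V * E) * L ^+ 2 by ring.
    by apply: mulr_ge0; [exact: mulr_ge0|exact: sqr_ge0].
  have [W0|W0] := posnP #|window_primes M|; first by rewrite /W W0 invr0 mulr0.
  have WR : 0 < W by rewrite ltr0n.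
  have hcw := Hc M M2 W0; rewrite -/W -/L in hcw.
  have hM : (M%:R / 2) `^ (- (2 * alpha)) <= c * V * E * M%:R.
    have -> : c * V = 2 `^ (2 * alpha) by rewrite /V mulrC divfK// gt_eqF.
    have h2 : 0 <= 2^-1 :> R by rewrite invr_ge0.
    have -> : (M%:R / 2) `^ (- (2 * alpha)) =
        2 `^ (2 * alpha) * M%:R `^ (- (2 * alpha)) :> R.
      rewrite (powRM _ (ltW M0) h2) mulrC; congr (_ * _).
      by rewrite -[2^-1]powR_inv1// -powRrM mulN1r opprK.
    rewrite -mulrA; apply: ler_wpM2l; first exact: powR_ge0.
    have -> : E * M%:R = M%:R `^ (- (2 * lambda + 1) + 1) by rewrite MD (powRr1 (ltW M0)).
    exact: ler_powR.
  by rewrite ler_pdivrMr//; exact: window_term_le hM hcw.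
pose X := (M%:R / 2) `^ (- (2 * alpha)) / W + Y.
have X0 : 0 <= X by rewrite addr_ge0// divr_ge0.
have XK : X <= (Num.sqrt K * M%:R `^ rate lambda delta * L) ^+ 2.
  rewrite !exprMn (sqr_sqrtr (ltW K0)).
  apply: (@le_trans _ _ (K * L ^+ 2 * E)).
    have -> : K * L ^+ 2 * E = 4 * L ^+ 2 * E + 4 * (A + 2) * D * L ^+ 2 * E + 2 * V * L ^+ 2 * E.
      by rewrite /K; ring.
    by rewrite /X addrC lerD// lerD.
  rewrite [leLHS]mulrAC; apply: ler_wpM2r; first exact: sqr_ge0.
  by apply: ler_wpM2l => //; exact: ltW.
apply: rms_error_le; first by apply: mulr_ge0;
    [rewrite mulr_ge0 ?sqrtr_ge0 ?powR_ge0|exact: ltW].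
move=> f bf; apply: (@le_trans _ _ X%:E); last by rewrite lee_fin.
apply: mse_le bf X0 _ => // k k0.
have [W0|W0] := posnP #|window_primes M|.
  rewrite W0 mul0r big_pred0// => N; by rewrite (card0_eq W0).
apply: le_trans (window_hit_le (t := lambda^-1) (T := T) (B := T `^ lambda) (p := p)
  a0 hgam a1 M2 Hbest k0 (powR_ge0 _ _) (ltW p0) _ _) _.
- by move=> N z N0 gz; exact: good_wce.
- move=> N pN hN; apply: (card_bad (S := S)) => //.
  + by rewrite invr_gt0.
  + by rewrite ler_pdivlMr// mul1r ltW.
  + have -> : p * T = 4 * S / M%:R by rewrite /T; field; rewrite !gt_eqF.
    have NR : 0 < N.-1%:R :> R by rewrite ltr0n -subn1 subn_gt0 prime_gt1.
    rewrite ler_pdivrMr// mulrAC ler_pdivlMr//.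
    have : M%:R <= 2 * N.-1%:R :> R by rewrite -natrM ler_nat window_pred_ge.
    move=> h; apply: (@le_trans _ _ (2 * S * (2 * N.-1%:R))).
      by rewrite ler_wpM2l// mulr_ge0// ltW.
    by rewrite le_eqVlt; apply/orP; left; apply/eqP; ring.
have WN : W != 0 by rewrite pnatr_eq0 -lt0n.
by rewrite -/Y -/W /X [leRHS]mulrDr (mulrC W (_ / W)) (mulfVK WN).
Qed.

End final.

(** From 1 + x <= exp x. *)
Lemma prod_decay_bound {R : realType} (t Z G : R) (gam : nat -> R) (d : nat) :
  0 <= Z -> \sum_(0 <= j < d) gam j `^ t <= G ->
  \prod_(j < d) (1 + 2 * gam j `^ t * Z) <= expR (2 * Z * G).
Proof.
move=> Z0 HG.
apply: (@le_trans _ _ (\prod_(j < d) expR (2 * Z * gam j `^ t))).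
  apply: ler_prod => j _; rewrite addr_ge0 ?mulr_ge0 ?powR_ge0//=.
  by rewrite mulrAC; exact: expR_ge1Dx.
rewrite -expR_sum ler_expR -mulr_sumr ler_wpM2l ?mulr_ge0//.
by rewrite big_mkord in HG.
Qed.

Theorem corollary3p7 (R : realType) (alpha eta : R) (gam : nat -> R)
    (halpha : 2^-1 < alpha) (hgam : forall j, 0 <= gam j <= 1)
    (heta : 0 < eta < 1) :
  [/\ forall d : nat, (0 < d)%N ->
      forall lambda delta : R, 2^-1 <= lambda < alpha ->
        0 < delta <= alpha^-1 ->
      exists2 C : R, 0 < C & rms_bound d alpha eta gam lambda delta C,
      ((fun p : R * R => rate p.1 p.2) @ filter_prod alpha^'- 0^'+
        --> - alpha - 2^-1)
    & cvgn (series (fun j => gam j `^ alpha^-1)) ->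
      forall lambda delta : R, 2^-1 <= lambda < alpha ->
        0 < delta <= alpha^-1 ->
      exists2 C : R, 0 < C &
        forall d : nat, (0 < d)%N ->
          rms_bound d alpha eta gam lambda delta C].
Proof.
have a0 : 0 < alpha by apply: lt_trans halpha.
have sumS lambda : 2^-1 <= lambda < alpha -> exists2 Z : R, 0 <= Z &
    forall (d : nat) (s : seq (d.-tuple int)), uniq s ->
    \sum_(k <- s) decay alpha gam k `^ lambda^-1 <=
    \prod_(j < d) (1 + 2 * gam j `^ lambda^-1 * Z).
  move=> /andP[l1 l2]; have l0 : 0 < lambda by apply: lt_le_trans l1.
  have s1 : 1 < alpha * lambda^-1 by rewrite ltr_pdivlMr// mul1r.
  have [Z HZ] := pseries_bounded s1.
  exists Z; first by have := HZ 0%N; rewrite big_geq.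
  by move=> d s us; apply: sum_decay_le => //; rewrite invr_gt0.
split.
- move=> d _ lambda delta hl /andP[dl0 _]; have [Z Z0 HZ] := sumS _ hl.
  pose S := \prod_(j < d) (1 + 2 * gam j `^ lambda^-1 * Z).
  have S0 : 0 < S by apply: prodr_gt0 => j _; rewrite ltr_pwDl// !mulr_ge0// powR_ge0.
  have [C C0 HC] := rms_bound_of_sum halpha hgam heta hl dl0 S0.
  by exists C => //; apply: HC => s us; exact: HZ.
- exact: rate_cvg.
- move=> cv lambda delta hl /andP[dl0 _]; have [Z Z0 HZ] := sumS _ hl.
  pose G := limn (series (fun j => gam j `^ alpha^-1)).
  have HG n : \sum_(0 <= j < n) gam j `^ alpha^-1 <= G.
    apply: (nondecreasing_cvgn_le _ cv).
    by apply: nondecreasing_series => j _ _; exact: powR_ge0.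
  have [C C0 HC] := rms_bound_of_sum halpha hgam heta hl dl0 (expR_gt0 (2 * Z * G)).
  exists C => // d _; apply: HC => s us; apply: le_trans (HZ d s us) _.
  apply: prod_decay_bound => //; apply: le_trans (HG d); apply: ler_sum => j _.
  have /andP[g0 g1] := hgam j; have [l1 l2] := andP hl.
  have l0 : 0 < lambda by apply: lt_le_trans l1.
  have [->|gN] := eqVneq (gam j) 0; first by rewrite !powR0 ?invr_eq0 ?gt_eqF.
  apply: ger_powR; first by rewrite lt_neqAle eq_sym gN g0.
  by rewrite lef_pV2 ?posrE// ltW.
Qed.
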